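(* (a) Let $0<\alpha<1$ and $0<p<1/(1+\alpha)$. Then there exists a constant $c_{\alpha,p}$, depending only on $\alpha$ and $p$, such that for all $F\in H_p(G)$ $$\left\|\widetilde{\sigma}_p^{\alpha,*}F\right\|_p\le c_{\alpha,p}\,\|F\|_{H_p},\qquad\text{where}\qquad \widetilde{\sigma}_p^{\alpha,*}F:=\sup_{n\in\mathbb{N}}\frac{|\sigma_n^\alpha F|}{(n+1)^{1/p-1-\alpha}}.$$ (b) Let $0<\alpha<1$, $0<p<1/(1+\alpha)$, and let $\varphi:\mathbb{N}_+\to[1,\infty)$ be a nondecreasing function satisfying $$\limsup_{n\to\infty}\frac{n^{1/p-1-\alpha}}{\varphi(n)}=\infty .$$ Then the maximal operator $$F\mapsto \sup_{n\in\mathbb{N}_+}\frac{|\sigma_n^\alpha F|}{\varphi(n)}$$ is not bounded from the Hardy space $H_p(G)$ to the space $L_p(G)$; that is, there is no finite constant $C$ such that $\left\|\sup_{n\in\mathbb{N}_+}|\sigma_n^\alpha F|/\varphi(n)\right\|_p\le C\|F\|_{H_p}$ for all $F\in H_p(G)$.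
   Context: $\mathbb{N}_+$ is the set of positive integers and $\mathbb{N}=\mathbb{N}_+\cup\{0\}$. The dyadic group: $\mathbb{Z}_2=\{0,1\}$ is the discrete cyclic group of order 2 (addition modulo 2) with the Haar measure giving each singleton measure $1/2$. $G$ is the complete direct product of countably many copies of $\mathbb{Z}_2$, with product topology and product (Haar probability) measure $\mu$; its elements are sequences $x=(x_0,x_1,\ldots)$ with $x_k\in\{0,1\}$. Dyadic intervals: $I_0(x):=G$ and $I_n(x):=\{y\in G: y_0=x_0,\ldots,y_{n-1}=x_{n-1}\}$ for $x\in G$, $n\ge1$. For $0<p<\infty$, $\|f\|_p:=\left(\int_G|f|^p\,d\mu\right)^{1/p}$, and $L_p(G)$ is the corresponding space of measurable functions with $\|f\|_p<\infty$. Walsh system: the Rademacher functions are $r_k(x):=(-1)^{x_k}$. Each $n\in\mathbb{N}$ is written uniquely as $n=\sum_{j=0}^\infty n_j2^j$ with $n_j\in\{0,1\}$, and $w_n(x):=\prod_{k=0}^\infty r_k(x)^{n_k}$. Martingales and Hardy spaces: $\mathcal{F}_n$ denotes the $\sigma$-algebra generated by the intervals $\{I_n(x):x\in G\}$. A martingale $F=(F_n,\ n\in\mathbb{N})$ is always a martingale with respect to $(\mathcal{F}_n,\ n\in\mathbb{N})$. Its maximal function is $F^*:=\sup_{n\in\mathbb{N}}|F_n|$, and for $0<p<\infty$ the Hardy martingale space $H_p(G)$ consists of all martingales $F$ with $\|F\|_{H_p}:=\|F^*\|_p<\infty$. Walsh–Fourier coefficients of a martingale $F$: $\widehat{F}(k):=\lim_{n\to\infty}\int_G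 F_nw_k\,d\mu$ (the limit exists for every $k\in\mathbb{N}$). A function $f\in L_1(G)$ is identified with the martingale $(S_{2^n}f,\ n\in\mathbb{N})$, for which $\widehat{F}(k)=\int_G f w_k\,d\mu$. Partial sums: $S_nF:=\sum_{k=0}^{n-1}\widehat{F}(k)w_k$ for $n\in\mathbb{N}_+$. Cesàro means: for $\beta\ne-1,-2,\ldots$ put $A_0^\beta:=1$ and $A_n^\beta:=\frac{(\beta+1)\cdots(\beta+n)}{n!}$ for $n\ge 1$. The $(C,\alpha)$ means are $$\sigma_n^\alpha F:=\frac{1}{A_n^\alpha}\sum_{k=1}^n A_{n-k}^{\alpha-1}S_kF,$$ where for $n=0$ the sum is empty, so $\sigma_0^\alpha F=0$. *)

(* Defs.v *)
From HB Require Import structures.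
From mathcomp Require Import all_boot all_order all_algebra.
From mathcomp Require Import all_classical all_reals all_analysis.
From mathcomp Require Import ring lra zify.

Set Implicit Arguments.
Unset Strict Implicit.
Unset Printing Implicit Defensive.

Import Order.TTheory GRing.Theory Num.Theory.
Import numFieldNormedType.Exports.

Local Open Scope classical_set_scope.
Local Open Scope ring_scope.

(* Z_2 is represented by bool, and G by the sequences nat -> bool with the
   product sigma-algebra, generated by the one-coordinate cylinders. *)
Definition coordinate_cylinders : set (set (nat -> bool)) :=
  [set A | exists k b, A = [set x | x k = b]].

Notation dyadic_group := (g_sigma_algebraType coordinate_cylinders).

Definition dyadic_interval (n : nat) (x : dyadic_group) : set dyadic_group :=
  [set y | forall k, (k < n)%N -> y k = x k].

(* The factors of the product are the measures A |-> #|A| / 2 on bool. *)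
Definition is_product_measure (R : realType)
    (mu : probability dyadic_group R) : Prop :=
  forall (n : nat) (A : nat -> {set bool}),
    mu [set x | forall k, (k < n)%N -> x k \in A k] =
      (\prod_(k < n) (#|A k|%:R / 2))%:E.

Section existence.
Variable R : realType.

(* Binary digits of t in [0, 1[: the product measure is the image of the
   Lebesgue measure on [0, 1[. *)
Let digits (t : measurableTypeR R) : dyadic_group :=
  fun k => odd (Num.truncn (2 ^+ k.+1 * t)).

Let measurable_digits : measurable_fun setT digits.
Proof.
refine (@measurability _ _ (measurableTypeR R) dyadic_group setT digits coordinate_cylinders _ _) => //.
move=> _ [_ [k [b ->]] <-]; rewrite setTI.
suff tr : measurable [set t : R | odd (Num.truncn (2 ^+ k.+1 * t))].
  case: b => //.
  rewrite (_ : _ @^-1` _ = ~` [set t : R | odd (Num.truncn (2 ^+ k.+1 * t))]).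
    exact: measurableC.
  by apply/seteqP; split => t /=; rewrite /digits; case: odd.
rewrite (_ : [set _ | _] =
  \bigcup_(j in [set j | odd j]) `[j%:R / 2 ^+ k.+1, j.+1%:R / 2 ^+ k.+1[%classic).
  by apply: bigcup_measurable => j _; exact: measurable_itv.
have e0 : (0 : R) < 2 ^+ k.+1 by rewrite exprn_gt0.
apply/seteqP; split => t /=.
  move=> ot; exists (Num.truncn (2 ^+ k.+1 * t)) => //=.
  rewrite in_itv /= ler_pdivrMr// ltr_pdivlMr// (mulrC t).
  apply: truncn_itv; rewrite leNgt; apply/negP => t0.
  move: ot; rewrite (_ : Num.truncn _ = 0%N)//.
  by apply/truncn0Pn; rewrite -ltNge (lt_trans t0).
move=> [j /= oj]; rewrite in_itv /= ler_pdivrMr// ltr_pdivlMr// (mulrC t).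
by move=> /truncn_def ->.
Qed.

HB.instance Definition _ := isMeasurableFun.Build _ _
  (measurableTypeR R) dyadic_group digits measurable_digits.

Let I01 : set (measurableTypeR R) := `[0%R, 1%R[%classic.
Let mI01 : measurable I01. Proof. exact: measurable_itv. Qed.

Let P01 := mrestr (@lebesgue_measure R) mI01.
HB.instance Definition _ := Measure.on P01.

Let P01T : P01 setT = 1%E.
Proof.
rewrite /P01 /mrestr setTI.
by rewrite /I01 lebesgue_measure_itv /= lte_fin ltr01 oppr0 adde0.
Qed.

HB.instance Definition _ := Measure_isProbability.Build _ _ _ P01 P01T.

Let nu : probability dyadic_group R := distribution P01 digits.

Let code (x : nat -> bool) : nat -> nat :=
  fix c n := if n is m.+1 then ((c m).*2 + x m)%N else 0%N.

Let half_truncn (t : R) n : 0 <= t ->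
  (Num.truncn (2 ^+ n.+1 * t))./2 = Num.truncn (2 ^+ n * t).
Proof.
move=> t0; apply/esym/truncn_def.
have /truncn_itv : 0 <= 2 ^+ n.+1 * t by rewrite mulr_ge0.
set m := Num.truncn _ => /andP[h1 h2].
have h : (m = odd m + (m./2).*2)%N by rewrite odd_double_half.
move: h1 h2; rewrite {1 2}h exprS.
set s := 2 ^+ n * t; rewrite -mulrA -/s -addSn -muln2 !natrD !natrM.
rewrite -[(m./2).+1%:R]natr1 -[(nat_of_bool (odd m)).+1%:R]natr1.
by case: (odd m) => /=; lra.
Qed.

Let digits_interval n (x : nat -> bool) (t : R) : 0 <= t < 1 ->
  (forall k, (k < n)%N -> digits t k = x k) <->
  (Num.truncn (2 ^+ n * t) = code x n).
Proof.
move=> /andP[t0 t1]; elim: n => [|n IH].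
  split => // _; rewrite expr0 mul1r /=; apply/truncn0Pn.
  by rewrite -ltNge.
rewrite /= -/(code x n); split.
  move=> h; rewrite -(odd_double_half (Num.truncn _)) half_truncn//.
  rewrite IH.1 => [|k kn]; last by apply: h; rewrite ltnW.
  by rewrite -(h n)// [LHS]addnC.
move=> h k; rewrite ltnS leq_eqVlt => /orP[/eqP ->|kn].
  by rewrite /digits h oddD odd_double /=; case: (x n).
apply: IH.2 k kn; rewrite -half_truncn// h addnC.
by rewrite halfD odd_double andbF add0n doubleK; case: (x n).
Qed.

Let code_lt x n : (code x n < 2 ^ n)%N.
Proof.
elim: n => //= n IH; rewrite -/(code x n) expnS.
by case: (x n); lia.
Qed.

Let nu_interval n x : nu (dyadic_interval n x) = (2^-1 ^+ n)%:E.
Proof.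
rewrite /nu /= /distribution /pushforward /P01 /mrestr.
have e0 : (0 : R) < 2 ^+ n by rewrite exprn_gt0.
rewrite (_ : _ `&` _ =
   `[(code x n)%:R / 2 ^+ n, (code x n).+1%:R / 2 ^+ n[%classic).
  rewrite lebesgue_measure_itv /= lte_fin ltr_pM2r ?invr_gt0// ltr_nat ltnSn.
  by rewrite -EFinB -mulrBl -natr1 addrAC subrr add0r mul1r exprVn.
apply/seteqP; split => t /=; rewrite /I01 /= !in_itv /=.
  move=> [h t01].
  have := (digits_interval n x t01).1 h.
  rewrite ler_pdivrMr// ltr_pdivlMr// (mulrC t) => <-.
  by apply: truncn_itv; rewrite mulr_ge0 ?exprn_ge0//; case/andP: t01.
move=> h.
have t01 : 0 <= t < 1.
  move/andP: h => [h1 h2]; rewrite (le_trans _ h1) ?divr_ge0 ?ler0n ?ltW//=.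
  rewrite (lt_le_trans h2)// ler_pdivrMr// mul1r -natrX ler_nat.
  exact: code_lt.
split => //; apply/(digits_interval n x t01)/truncn_def.
by move: h; rewrite ler_pdivrMr// ltr_pdivlMr// (mulrC t).
Qed.

Let measurable_coord k b : measurable [set y : dyadic_group | y k = b].
Proof. by apply: sub_sigma_algebra; exists k, b. Qed.

Let measurable_coordS k (B : {set bool}) :
  measurable [set y : dyadic_group | y k \in B].
Proof.
rewrite (_ : [set _ | _] = \bigcup_(b in [set b | b \in B]) [set y | y k = b]).
  by apply: fin_bigcup_measurable => // b _; exact: measurable_coord.
by apply/seteqP; split => y /= => [h|[b /= + ->//]]; exists (y k).
Qed.

Let box n (x : nat -> bool) m (A : nat -> {set bool}) : set dyadic_group :=
  dyadic_interval n x `&` [set y | forall k, (k < m)%N -> y (n + k)%N \in A k].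

Let measurable_box n x m A : measurable (box n x m A).
Proof.
apply: measurableI.
  rewrite (_ : dyadic_interval n x =
    \bigcap_(k in [set k | (k < n)%N]) [set y | y k = x k]) //.
  by apply: bigcap_measurableType => k _; exact: measurable_coord.
rewrite (_ : [set y | _] =
  \bigcap_(k in [set k | (k < m)%N]) [set y | y (n + k)%N \in A k]) //.
by apply: bigcap_measurableType => k _; exact: measurable_coordS.
Qed.

Let nu_box m : forall n x A,
  nu (box n x m A) = (2^-1 ^+ n * \prod_(k < m) (#|A k|%:R / 2))%:E.
Proof.
elim: m => [|m IH] n x A.
  rewrite big_ord0 mulr1 -(nu_interval n x); congr (nu _).
  by apply/seteqP; split => [y []//|y h]; split.
pose xb (b : bool) k := if (k < n)%N then x k else b.
have split_box b : box n x m.+1 A `&` [set y | y n = b] =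
    if b \in A 0%N then box n.+1 (xb b) m (fun k => A k.+1) else set0.
  apply/seteqP; split => y.
    move=> [[/= h1 h2] h3]; have := h2 0%N isT; rewrite addn0 h3 => ->.
    split => k kn; last by rewrite addSnnS; exact: h2.
    rewrite /xb; case: ltnP => [/h1//|nk].
    by rewrite (_ : k = n)//; apply/eqP; rewrite eqn_leq nk andbT -ltnS.
  case: ifPn => // bA [/= h1 h2].
  have yn : y n = b by rewrite h1// /xb ltnn.
  split => //; split => k kn; first by rewrite (h1 k (ltnW kn)) /xb kn.
  by case: k kn => [_|k km]; rewrite ?addn0 ?yn// -addSnnS; exact: h2.
pose half b := box n x m.+1 A `&` [set y | y n = b].
have mhalf b : measurable (half b).
  by apply: measurableI; [exact: measurable_box|exact: measurable_coord].
have nu_half b : nu (half b) = (if b \in A 0%N then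
    2^-1 ^+ n.+1 * \prod_(k < m) (#|A k.+1|%:R / 2) else 0)%:E.
  by rewrite /half split_box; case: ifP => _; [rewrite IH|rewrite measure0].
have -> : nu (box n x m.+1 A) = (nu (half true) + nu (half false))%E.
  rewrite -measureU//; last first.
    apply/seteqP; split => y //; rewrite /half.
    by move=> [[_ /= yT] [_ /= yF]]; rewrite yT in yF.
  congr (nu _); rewrite /half -setIUr; apply/esym/setIidPl => y _ /=.
  by case: (y n); [left|right].
rewrite !nu_half -EFinD big_ord_recl /=; congr EFin.
have -> : #|A 0%N| = ((true \in A 0%N) + (false \in A 0%N))%N.
  by rewrite -sum1_card big_mkcond /= big_bool; do 2 case: ifP => _.
set Q := (X in _ ^+ n.+1 * X); rewrite (_ : \prod_(i < m) _ = Q)//.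
rewrite exprS; move: (_ ^+ n) => u.
by case: ifP => _; case: ifP => _; rewrite ?natrD /=; field.
Qed.

Lemma product_measure_exists :
  exists mu : probability dyadic_group R, is_product_measure mu.
Proof.
exists nu => n A; have -> : [set x : dyadic_group |
    forall k, (k < n)%N -> x k \in A k] = box 0 (fun=> false) n A.
  by apply/seteqP; split => [y h|y []//]; split.
by rewrite nu_box expr0 mul1r.
Qed.

End existence.

Lemma product_measure_unique (R : realType)
    (mu mu' : probability dyadic_group R) :
  is_product_measure mu -> is_product_measure mu' ->
  forall A, measurable A -> mu A = mu' A.
Proof.
move=> muP mu'P.
pose box n (A : nat -> {set bool}) : set dyadic_group :=
  [set x | forall k, (k < n)%N -> x k \in A k].
pose boxes : set (set dyadic_group) := [set B | exists n A, B = box n A].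
have mbox B : boxes B -> measurable B.
  move=> [n [A ->]]; rewrite (_ : box n A = \bigcap_(k in [set k | (k < n)%N])
    \bigcup_(b in [set b | b \in A k]) [set y : dyadic_group | y k = b]).
    apply: bigcap_measurableType => k _; apply: fin_bigcup_measurable => // b _.
    by apply: sub_sigma_algebra; exists k, b.
  apply/seteqP; split => y h k kn; first by exists (y k) => //; exact: h.
  by have [b /= bA ->] := h _ kn.
have boxesT : boxes setT.
  by exists 0%N, (fun=> finset.setT); apply/seteqP; split => // y _ k.
have boxesI : setI_closed boxes.
  move=> _ _ [n [A ->]] [m [B ->]].
  exists (maxn n m), (fun k => (if (k < n)%N then A k else finset.setT) :&:
                             (if (k < m)%N then B k else finset.setT))%SET.
  apply/seteqP; split => y.
    move=> [yA yB] k _; rewrite finset.in_setI.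
    by case: ifPn => [/yA ->|_]; case: ifPn => [/yB ->|_]; rewrite ?finset.in_setT.
  move=> h; split => k kn; have := h k; rewrite leq_max kn ?orbT finset.in_setI.
    by move=> /(_ isT)/andP[].
  by move=> /(_ isT)/andP[].
have boxesE : @measurable _ dyadic_group = <<s boxes >>.
  apply/seteqP; split; last exact: (smallest_sub (@sigma_algebra_measurable _ dyadic_group) mbox).
  apply: smallest_sub; first exact: smallest_sigma_algebra.
  move=> _ [k [b ->]]; apply: sub_sigma_algebra.
  exists k.+1, (fun j => if j == k then finset.set1 b else finset.setT).
  apply/seteqP; split => y /=.
    by move=> yb j _; case: eqP => [->|_]; rewrite ?yb ?finset.in_set1 ?finset.in_setT.
  by move=> /(_ k (ltnSn k)); rewrite eqxx finset.in_set1 => /eqP.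
apply: (measure_unique boxes (fun=> setT)) => //.
- by apply/seteqP; split => // y _; exists 0%N.
- by move=> _ [n [A ->]]; exact: etrans (muP n A) (esym (mu'P n A)).
- by move=> k; rewrite (le_lt_trans (probability_le1 _ _)) ?ltry.
Qed.

Definition haar (R : realType) : probability dyadic_group R :=
  sval (cid (@product_measure_exists R)).

Lemma haarP (R : realType) : is_product_measure (haar R).
Proof. exact: svalP (cid (@product_measure_exists R)). Qed.


Section walsh_hardy.
Variable R : realType.
Implicit Types (x : dyadic_group) (F : nat -> dyadic_group -> R) (n k : nat).

Local Notation mu := (haar R).

Definition rademacher k x : R := (-1) ^+ x k.

Definition binary_digit n k : nat := odd (n %/ 2 ^ k).

(* The factors with k >= n are omitted: they are 1, as n < 2 ^ n. *)
Definition walsh n x : R := \prod_(k < n) rademacher k x ^+ binary_digit n k.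

Definition dyadic_filtration n : set (set dyadic_group) :=
  <<s range (dyadic_interval n) >>.

Record martingale F : Prop := {
  martingale_adapted : forall n (B : set R), measurable B ->
    dyadic_filtration n (F n @^-1` B) ;
  martingale_integrable : forall n, mu.-integrable setT (EFin \o F n) ;
  (* E[F n | dyadic_filtration m] = F m *)
  martingale_condexp : forall m n (A : set dyadic_group), (m <= n)%N ->
    dyadic_filtration m A ->
    (\int[mu]_(x in A) (F n x)%:E = \int[mu]_(x in A) (F m x)%:E)%E }.

Definition maximal_function F x : \bar R :=
  ereal_sup (range (fun n => `|F n x|%:E)).

Definition hardy_norm (p : R) F : \bar R := 'N[mu]_p%:E[maximal_function F]%E.

Definition hardy (p : R) F : Prop := martingale F /\ (hardy_norm p F < +oo)%E.

Definition walsh_coef F k : R :=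
  limn (fun n => \int[mu]_x (F n x * walsh k x)).

Definition partial_sum n F x : R := \sum_(k < n) walsh_coef F k * walsh k x.

Definition cesaro_coef (beta : R) n : R :=
  (\prod_(1 <= j < n.+1) (beta + j%:R)) / n`!%:R.

Definition cesaro_mean (alpha : R) n F x : R :=
  (cesaro_coef alpha n)^-1 *
  \sum_(1 <= k < n.+1) cesaro_coef (alpha - 1) (n - k) * partial_sum k F x.

(* sup over n in D of |sigma_n^alpha F| / w n *)
Definition weighted_maximal (alpha : R) (D : set nat) (w : nat -> R) F x
    : \bar R :=
  ereal_sup [set (`|cesaro_mean alpha n F x| / w n)%:E | n in D].

End walsh_hardy.

(* Main.v *)
Require Import Defs.
From mathcomp Require Import all_boot all_order all_algebra.
From mathcomp Require Import all_classical all_reals all_analysis.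
From mathcomp Require Import measurable_realfun.
From mathcomp Require Import ring lra zify.
Import Order.TTheory GRing.Theory Num.Theory.
Import numFieldNormedType.Exports.
Set Implicit Arguments.
Unset Strict Implicit.
Unset Printing Implicit Defensive.
Local Open Scope classical_set_scope.
Local Open Scope ring_scope.

(** Write [A_j] for [cesaro_coef (alpha - 1) j], [D_k] for the Dirichlet kernels
    and [K_n = sum_(k <= n) A_(n - k) D_k] for the unnormalised Cesaro kernels.

    For the boundedness, suppose [n < 2 ^ M].  The first [n] Walsh coefficients of a
    martingale [F] are those of [F_M], so [A_n^alpha sigma_n F (x)] is the average of
    [F_M(s) K_n(s + x)] over the [2 ^ M] cells [s] of the dyadic partition of level
    [M] ([cesaro_meanE]).  As [p < 1], the [p]-th power of this sum is at most the sum
    of the [p]-th powers.  Hence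
      [|A_n^alpha sigma_n F (x)| ^ p <= 2 ^ (M (1 - p)) Psi(x)],
    where [Psi] is the convolution of [(F^* ) ^ p] with a majorant of all the
    functions [|K_n| ^ p] ([kernel_sum_le_majorant]).  The factor
    [2 ^ (M (1 - p))], of order [n ^ (1 - p)], is up to a constant factor the
    [p]-th power of [A_n^alpha] times the weight [(n + 1) ^ (1/p - 1 - alpha)], because
    [A_n^alpha] lies between [(n + 1) ^ alpha] and twice this number.  So the
    supremum over [n] costs nothing, and translation invariance of the Haar
    measure reduces the claim to the integrability of [sup_n |K_n| ^ p]
    ([integral_majorant_le]).

    The kernels are estimated by means of the first two ones of [x], at positions
    [k < l].  The sequence [D_j(x)] is then made of blocks of length [2 ^ (l + 1)]
    that agree up to sign and sum to zero ([dirichlet_block],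
    [sum_dirichlet_eq0]).  Since [A_j] decreases, summation by parts gives
    [|K_n(x)| <= 24 * 2 ^ ((1 + alpha) l)] ([cesaro_kernel_bound]).  Such [x] are
    among the [l + 1] dyadic intervals of length [2 ^ -l] on which at most one of
    the first [l] coordinates is a one, and
    [sum_l (l + 1) 2 ^ -l 2 ^ (p (1 + alpha) l)] converges precisely because
    [p (1 + alpha) < 1].

    For the second part take [f_N = r_N D_(2 ^ N)], whose Hardy norm is at most
    [2 ^ (N (1 - 1/p))].  Its Walsh coefficients of index below [2 ^ N] vanish and
    the one of index [2 ^ N] is [1]; so the Cesaro mean of order [n = 2 ^ N + 1]
    has the single nonzero term [A_0 S_n f_N = r_N], and its modulus is the
    constant [1 / A_n^alpha], of order [2 ^ (- alpha N)]
    ([cesaro_mean_block]).  A bound [C] for the maximal operator would therefore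
    bound [2 ^ (N (1/p - 1 - alpha)) / phi (2 ^ N + 1)], and by monotonicity of
    [phi] also [n ^ (1/p - 1 - alpha) / phi n] for [2 ^ N < n <= 2 ^ (N + 1)]. *)

(** * Walsh functions and Dirichlet kernels *)

Section walsh_dirichlet.
Variable R : realType.
Implicit Types (x y : dyadic_group) (i j k l n m q r L N : nat).
Local Notation rad := (rademacher R).
Local Notation walsh := (walsh R).

Lemma binary_digit_small n k : (n < 2 ^ k)%N -> binary_digit n k = 0%N.
Proof. by move=> nk; rewrite /binary_digit divn_small. Qed.

Lemma binary_digit_block i L r k : (r < 2 ^ L)%N ->
  binary_digit (i * 2 ^ L + r) k =
    (binary_digit (i * 2 ^ L) k + binary_digit r k)%N.
Proof.
move=> rL; case: (ltnP k L) => kL.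
  have [d ->] : exists d, L = (d.+1 + k)%N by exists (L - k.+1)%N; lia.
  rewrite /binary_digit expnD mulnA divnMDl ?expn_gt0// mulnK ?expn_gt0//.
  by rewrite oddD oddM oddX andbF addFb.
rewrite (binary_digit_small (n := r)); last by rewrite (leq_trans rL)// leq_pexp2l.
rewrite addn0 /binary_digit -(subnKC kL) expnD !divnMA mulnK ?expn_gt0//.
by rewrite divnMDl ?expn_gt0// (divn_small rL) addn0.
Qed.

Lemma walsh_wide n N x : (n < 2 ^ N)%N ->
  walsh n x = \prod_(k < N) rad k x ^+ binary_digit n k.
Proof.
move=> nN; pose f k := rad k x ^+ binary_digit n k.
have trim K K' : (n < 2 ^ K)%N -> (K <= K')%N ->
    \prod_(k < K') f k = \prod_(k < K) f k.
  move=> nK /subnK <-; rewrite addnC; elim: (K' - K)%N => [|d IH].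
    by rewrite addn0.
  rewrite addnS big_ord_recr /= IH /f binary_digit_small ?expr0 ?mulr1//.
  by rewrite (leq_trans nK)// leq_pexp2l// leq_addr.
rewrite /walsh -!/(f _); case: (leqP n N) => [h|/ltnW h].
  by rewrite -(trim n N)// ltn_expl.
by rewrite (trim N n).
Qed.

Lemma rademacher_sqr k x : rad k x * rad k x = 1.
Proof. by rewrite /rademacher -expr2 sqrr_sign. Qed.

Lemma normr_walsh n x : `|walsh n x| = 1.
Proof.
rewrite /walsh normr_prod big1// => k _.
by rewrite normrX /rademacher normr_sign expr1n.
Qed.

Definition dyadic_add x y : dyadic_group := fun k => x k (+) y k.

Lemma walsh_add n x y : walsh n (dyadic_add x y) = walsh n x * walsh n y.
Proof.
rewrite /walsh -big_split /=; apply: eq_bigr => k _.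
by rewrite -exprMn /rademacher /dyadic_add signr_addb.
Qed.

Lemma walsh_low n m x : (n < 2 ^ m)%N ->
  forall y, dyadic_interval m x y -> walsh n y = walsh n x.
Proof.
move=> nm y xy; rewrite !(walsh_wide _ nm); apply: eq_bigr => k _.
by rewrite /rademacher xy.
Qed.

Lemma walsh_block i L r x : (r < 2 ^ L)%N ->
  walsh (i * 2 ^ L + r) x = walsh (i * 2 ^ L) x * walsh r x.
Proof.
move=> rL; set n := (i * 2 ^ L + r)%N.
have nn : (n < 2 ^ n)%N by rewrite ltn_expl.
rewrite (walsh_wide _ nn).
rewrite (walsh_wide (N := n) (n := i * 2 ^ L)) ?(leq_ltn_trans _ nn) ?leq_addr//.
rewrite (walsh_wide (N := n) (n := r)) ?(leq_ltn_trans _ nn) ?leq_addl//.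
rewrite -big_split /=; apply: eq_bigr => k _; rewrite -exprD; congr (_ ^+ _).
exact: binary_digit_block.
Qed.

Lemma walsh_pow2 k x : walsh (2 ^ k) x = rad k x.
Proof.
have kk : (2 ^ k < 2 ^ k.+1)%N by rewrite ltn_exp2l.
rewrite (walsh_wide _ kk) big_ord_recr /= /binary_digit divnn expn_gt0 expr1.
rewrite big1 ?mul1r// => i _.
rewrite -expnB ?(ltnW (ltn_ord i))//.
rewrite -(subnSK (ltn_ord i)) expnS.
by rewrite oddM.
Qed.

(** Complete blocks cancel, so that only the incomplete last one is left.  This is
    used twice: for the Walsh functions themselves, and then for the Dirichlet
    kernels that result from their summation. *)
Lemma sum_blocks (f e : nat -> R) B q r :
  (forall i s, (s < B)%N -> f (i * B + s)%N = e i * f s) ->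
  \sum_(s < B) f s = 0 -> (r <= B)%N ->
  \sum_(j < q * B + r) f j = e q * \sum_(j < r) f j.
Proof.
move=> fe f0; elim: q r => [|q IH] r rB.
  rewrite mul0n add0n mulr_sumr; apply: eq_bigr => j _.
  by rewrite -(fe 0%N)// (leq_trans (ltn_ord j)).
rewrite mulSnr big_split_ord /= IH// f0 mulr0 add0r mulr_sumr.
apply: eq_bigr => j _; rewrite -mulSnr fe//.
exact: leq_trans (ltn_ord j) rB.
Qed.

Definition dirichlet k x : R := \sum_(j < k) walsh j x.

Lemma normr_dirichlet k x : `|dirichlet k x| <= k%:R.
Proof.
rewrite (le_trans (ler_norm_sum _ _ _))//.
by rewrite (eq_bigr (fun=> 1)) ?sumr_const ?card_ord// => i _; exact: normr_walsh.
Qed.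

Lemma dirichlet_pow2S k x :
  dirichlet (2 ^ k.+1) x = (1 + rad k x) * dirichlet (2 ^ k) x.
Proof.
rewrite /dirichlet expnS mul2n -addnn big_split_ord /= mulrDl mul1r; congr (_ + _).
rewrite mulr_sumr; apply: eq_bigr => j _.
by rewrite -walsh_pow2 -{1}[(2 ^ k)%N]mul1n walsh_block// mul1n.
Qed.

Lemma dirichlet_pow2 N x : (forall k, (k < N)%N -> x k = false) ->
  dirichlet (2 ^ N) x = 2 ^+ N.
Proof.
elim: N => [|N IH] x0.
  by rewrite /dirichlet big_ord1 /walsh big_ord0 expr0.
rewrite dirichlet_pow2S IH; last by move=> k kN; exact/x0/ltnW.
by rewrite /rademacher x0// expr0 exprS.
Qed.

Lemma dirichlet_pow2_eq0 k L x : x k -> (k < L)%N -> dirichlet (2 ^ L) x = 0.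
Proof.
move=> xk; elim: L => // L IH; rewrite ltnS leq_eqVlt dirichlet_pow2S.
move=> /orP[/eqP <-|/IH ->]; last by rewrite mulr0.
by rewrite /rademacher xk expr1 subrr mul0r.
Qed.

Lemma dirichlet_block k L q r x : x k -> (k < L)%N -> (r <= 2 ^ L)%N ->
  dirichlet (q * 2 ^ L + r) x = walsh (q * 2 ^ L) x * dirichlet r x.
Proof.
move=> xk kL rL.
apply: (sum_blocks (f := fun j => walsh j x) (e := fun q => walsh (q * 2 ^ L) x)) => //.
  by move=> i s sL; exact: walsh_block.
exact: dirichlet_pow2_eq0 xk kL.
Qed.

(** The two halves of the block cancel: the one at [k] makes
    [D_(2 ^ l + r) (x) = w_(2 ^ l) (x) D_r (x)], and the one at [l] makes the factor
    equal to [-1]. *)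
Lemma sum_dirichlet_eq0 k l x : x k -> (k < l)%N -> x l ->
  \sum_(r < 2 ^ l.+1) dirichlet r x = 0.
Proof.
move=> xk kl xl; rewrite expnS mul2n -addnn big_split_ord /= -big_split /= big1//.
move=> r _; rewrite -{2}[(2 ^ l)%N]mul1n (dirichlet_block (k := k))//; last exact: ltnW.
by rewrite mul1n walsh_pow2 /rademacher xl expr1 mulN1r subrr.
Qed.

Lemma normr_dirichlet_le k L n x : x k -> (k < L)%N ->
  `|dirichlet n x| <= 2 ^+ L.
Proof.
move=> xk kL; rewrite (divn_eq n (2 ^ L)).
rewrite (dirichlet_block _ xk kL) ?normrM ?normr_walsh ?mul1r; last first.
  by rewrite ltnW// ltn_mod expn_gt0.
by rewrite (le_trans (normr_dirichlet _ _))// -natrX ler_nat ltnW// ltn_mod expn_gt0.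
Qed.

Lemma normr_sum_dirichlet_le k l n x : x k -> (k < l)%N -> x l ->
  `|\sum_(j < n) dirichlet j x| <= (2 ^+ l.+1) ^+ 2.
Proof.
move=> xk kl xl; have kL : (k < l.+1)%N by rewrite ltnW.
rewrite (divn_eq n (2 ^ l.+1)).
have rL : (n %% 2 ^ l.+1 < 2 ^ l.+1)%N by rewrite ltn_mod expn_gt0.
rewrite (sum_blocks (f := fun j => dirichlet j x)
    (e := fun q => walsh (q * 2 ^ l.+1) x) (B := (2 ^ l.+1)%N)); last exact: ltnW.
- rewrite normrM normr_walsh mul1r (le_trans (ler_norm_sum _ _ _))//.
  apply: (@le_trans _ _ (\sum_(j < n %% 2 ^ l.+1) 2 ^+ l.+1)).
    by apply: ler_sum => j _; exact: normr_dirichlet_le xk kL.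
  rewrite sumr_const card_ord expr2 -[leLHS]mulr_natr ler_wpM2l ?exprn_ge0//.
  by rewrite -natrX ler_nat ltnW.
- by move=> i s sB; apply: dirichlet_block xk kL _; exact: ltnW.
- exact: sum_dirichlet_eq0 xk kl xl.
Qed.

End walsh_dirichlet.

(** * Cesaro numbers and inequalities for powers *)

Section cesaro_numbers.
Variable R : realType.
Implicit Types (a b p : R) (j n N : nat).
Local Notation A := (@cesaro_coef R).

(** Young's inequality for [(1 + u) ^ a] and [1], with exponents [1 / a] and
    [1 / (1 - a)]. *)
Lemma bernoulli_powR a u : 0 < a < 1 -> 0 <= 1 + u -> (1 + u) `^ a <= 1 + a * u.
Proof.
move=> /andP[a0 a1] u0.
have a1' : 0 < 1 - a by rewrite subr_gt0.
have := @conjugate_powR R ((1 + u) `^ a) 1 a^-1 (1 - a)^-1 (powR_ge0 _ _) ler01.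
rewrite !invr_gt0 !invrK => /(_ a0 a1' _)/le_trans.
rewrite mulr1 -powRrM mulfV ?gt_eqF// powRr1// powR1 mul1r; apply; lra.
Qed.

(** After division by [a + b], add two instances of [u ^ p >= u] for [0 <= u <= 1]. *)
Lemma powR_le_add p a b : 0 < p <= 1 -> 0 <= a -> 0 <= b ->
  (a + b) `^ p <= a `^ p + b `^ p.
Proof.
move=> /andP[p0 p1] a0 b0.
have [s0|s0] := eqVneq (a + b) 0.
  by rewrite s0 powR0 ?gt_eqF// addr_ge0 ?powR_ge0.
have {}s0 : 0 < a + b by rewrite lt0r s0 addr_ge0.
have key c : 0 <= c -> c <= a + b -> (a + b) `^ p * (c / (a + b)) <= c `^ p.
  rewrite le_eqVlt => /orP[/eqP <- _|c0 cs]; first by rewrite mul0r mulr0 powR_ge0.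
  rewrite -{2}(divfK (lt0r_neq0 s0) c) powRM ?divr_ge0 ?(ltW c0) ?(ltW s0)//.
  rewrite mulrC ler_wpM2r ?powR_ge0// ger1_powR// divr_gt0//=.
  by rewrite ler_pdivrMr// mul1r.
rewrite (le_trans _ (lerD (key a a0 _) (key b b0 _))) ?lerDl ?lerDr//.
by rewrite -mulrDr -mulrDl divff ?gt_eqF// mulr1.
Qed.

Lemma powR_sum_le p (I : Type) (s : seq I) (P : pred I) (F : I -> R) : 0 < p <= 1 ->
  (forall i, P i -> 0 <= F i) ->
  (\sum_(i <- s | P i) F i) `^ p <= \sum_(i <- s | P i) F i `^ p.
Proof.
move=> p01 F0.
suff : (\sum_(i <- s | P i) F i) `^ p <= \sum_(i <- s | P i) F i `^ p
  /\ 0 <= \sum_(i <- s | P i) F i by case.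
apply: (big_rec2 (fun x y => y `^ p <= x /\ 0 <= y)).
  by rewrite powR0// gt_eqF//; case/andP: p01.
move=> i x y Pi [yx y0]; split; last by rewrite addr_ge0 ?F0.
by rewrite (le_trans (powR_le_add p01 (F0 _ Pi) y0))// lerD2l.
Qed.

Lemma cesaro_coef0 a : A a 0 = 1.
Proof. by rewrite /cesaro_coef big_geq// mul1r invr1. Qed.

Lemma cesaro_coefS a n : A a n.+1 = A a n * ((a + n.+1%:R) / n.+1%:R).
Proof.
rewrite /cesaro_coef big_nat_recr//= factS natrM invfM.
by rewrite [X in _ * X = _]mulrC mulrACA.
Qed.

Section fixed_order.
Variable a : R.
Hypotheses (a0 : 0 < a) (a1 : a < 1).
Let a01 : 0 < a < 1. Proof. by rewrite a0. Qed.

Lemma cesaro_coef_gt0 n : 0 < A (a - 1) n.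
Proof.
elim: n => [|n IH]; first by rewrite cesaro_coef0 ltr01.
rewrite cesaro_coefS mulr_gt0// divr_gt0//.
by rewrite -natr1 addrCA subrK ltr_wpDl.
Qed.

Lemma cesaro_coef_noninc m n : (m <= n)%N -> A (a - 1) n <= A (a - 1) m.
Proof.
elim: n => [|n IH]; first by rewrite leqn0 => /eqP ->.
rewrite leq_eqVlt => /orP[/eqP <-//|]; rewrite ltnS => /IH; apply: le_trans.
rewrite cesaro_coefS ler_piMr ?(ltW (cesaro_coef_gt0 n))// ler_pdivrMr// mul1r.
by rewrite gerDr subr_le0 ltW.
Qed.

Lemma cesaro_coef_shift n : A (a - 1) n.+1 = A a n * (a / n.+1%:R).
Proof.
elim: n => [|n IH].
  by rewrite cesaro_coefS !cesaro_coef0 subrK.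
rewrite cesaro_coefS IH cesaro_coefS -!natr1.
have n0 := ler0n R n; field; rewrite -?natr1; apply/andP; split; apply: lt0r_neq0; lra.
Qed.

Lemma sum_cesaro_coef n : \sum_(j < n.+1) A (a - 1) j = A a n.
Proof.
elim: n => [|n IH]; first by rewrite big_ord1 !cesaro_coef0.
rewrite big_ord_recr /= IH cesaro_coef_shift cesaro_coefS.
by rewrite mulrDl divff// mulrDr mulr1 addrC.
Qed.

(** [A_n^a] is the product of the [1 + a / j], and Bernoulli's inequality bounds
    each factor from below by [((j + 1) / j) ^ a]; the product telescopes. *)
Lemma cesaro_coef_lower n : n.+1%:R `^ a <= A a n.
Proof.
elim: n => [|n IH]; first by rewrite cesaro_coef0 powR1.
rewrite cesaro_coefS; have n0 : (0 : R) < n.+1%:R by [].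
have -> : n.+2%:R = n.+1%:R * (1 + n.+1%:R^-1) :> R.
  by rewrite mulrDr mulr1 divff ?gt_eqF// natr1.
have i0 : 0 < n.+1%:R^-1 :> R by rewrite invr_gt0.
have j0 : 0 <= 1 + n.+1%:R^-1 :> R by rewrite addr_ge0// ltW.
rewrite powRM// ler_pM ?powR_ge0//.
rewrite (le_trans (bernoulli_powR a01 j0))//.
by rewrite mulrDl divff ?gt_eqF// addrC.
Qed.

(** Bernoulli's inequality at [- 1 / v] bounds the factor [1 + a / v] by
    [(v / (v - 1)) ^ a], since [(1 + a / v) (1 - a / v) <= 1]; the product telescopes. *)
Lemma cesaro_coef_upper n : A a n <= 2 * n.+1%:R `^ a.
Proof.
case: n => [|n]; first by rewrite cesaro_coef0 powR1; lra.
suff h : A a n.+1 <= 2 * n.+1%:R `^ a.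
  rewrite (le_trans h)// ler_wpM2l// ge0_ler_powR ?nnegrE ?ler_nat//.
  exact: ltW.
elim: n => [|n IH]; first by rewrite cesaro_coefS cesaro_coef0 powR1 divr1 mul1r mulr1 lerD2r ltW.
rewrite cesaro_coefS; set v : R := n.+2%:R.
have v0 : 0 < v by [].
have v1 : 1 <= v by rewrite /v ler1n.
have i1 : v^-1 <= 1 by rewrite invf_le1.
have i0 : 0 < v^-1 by rewrite invr_gt0.
have bern := @bernoulli_powR a (- v^-1) a01.
have e : n.+1%:R = v * (1 - v^-1) :> R.
  by rewrite mulrBr mulr1 divff ?gt_eqF// /v -[n.+2%:R]natr1 addrK.
have j0 : 0 <= 1 - v^-1 by rewrite subr_ge0.
have vp : 0 <= v `^ a by rewrite powR_ge0.
have q0 : 0 <= (a + v) / v by rewrite divr_ge0 ?addr_ge0// ltW.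
apply: le_trans (ler_wpM2r q0 IH) _.
rewrite -mulrA ler_wpM2l// e powRM ?(ltW v0)//.
rewrite mulrDl divff ?gt_eqF// -mulrA ler_piMr//.
have {}bern : (1 - v^-1) `^ a <= 1 - a * v^-1 by rewrite -mulrN bern.
have k0 : 0 <= a / v + 1 by rewrite addr_ge0// mulr_ge0// ltW.
apply: le_trans (ler_wpM2r k0 bern) _.
have -> : (1 - a / v) * (a / v + 1) = 1 - (a / v) ^+ 2 by ring.
by rewrite gerBl sqr_ge0.
Qed.

End fixed_order.

(** Summation by parts, for weights that increase with the index. *)
Lemma abel_bound (c b : nat -> R) (S : R) n :
  (forall m, `|\sum_(j < m) b j| <= S) ->
  (forall i j, (i <= j <= n)%N -> c i <= c j) -> 0 <= c 0%N ->
  `|\sum_(j < n.+1) c j * b j| <= 2 * c n * S.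
Proof.
move=> bS cmono c0.
have S0 : 0 <= S by rewrite (le_trans _ (bS 0%N)).
pose B m := \sum_(j < m) b j.
have parts m : \sum_(j < m.+1) c j * b j =
    c m * B m.+1 - \sum_(j < m) (c j.+1 - c j) * B j.+1.
  elim: m => [|m IH]; first by rewrite /B !big_ord1 big_ord0 subr0.
  rewrite big_ord_recr /= IH [in RHS]big_ord_recr /=.
  have -> : B m.+2 = B m.+1 + b m.+1 by rewrite /B big_ord_recr.
  ring.
rewrite parts (le_trans (ler_normB _ _))//.
have cn : 0 <= c n by rewrite (le_trans c0) ?cmono ?leqnn.
have -> : 2 * c n * S = c n * S + c n * S by ring.
rewrite lerD//; first by rewrite normrM (ger0_norm cn) ler_wpM2l ?bS.
rewrite (le_trans (ler_norm_sum _ _ _))//.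
apply: (@le_trans _ _ (\sum_(j < n) (c j.+1 - c j) * S)).
  apply: ler_sum => j _; have cj : 0 <= c j.+1 - c j.
    by rewrite subr_ge0; apply: cmono; rewrite leqnSn; exact: ltn_ord.
  by rewrite normrM (ger0_norm cj) ler_wpM2l ?bS.
rewrite -mulr_suml -(big_mkord xpredT (fun j => c j.+1 - c j)) telescope_sumr//.
by rewrite ler_wpM2r// gerDl oppr_le0.
Qed.

End cesaro_numbers.

(** * Estimate of the Cesaro kernels *)

Section cesaro_kernel.
Variables (R : realType) (a : R).
Hypotheses (a0 : 0 < a) (a1 : a < 1).
Implicit Types (x y : dyadic_group) (i j k l n m M : nat).
Local Notation A := (@cesaro_coef R).

(** The kernel of [sigma_n^a] multiplied by [A_n^a]; the term [k = 0] is zero. *)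
Definition cesaro_kernel n x : R :=
  \sum_(k < n.+1) A (a - 1) (n - k) * dirichlet R k x.

Lemma sum_cesaro_coef_rev n : \sum_(k < n.+1) A (a - 1) (n - k) = A a n.
Proof.
rewrite -(sum_cesaro_coef a n) (reindex_inj rev_ord_inj) /=.
by apply: eq_bigr => k _; rewrite subSS subKn// -ltnS.
Qed.

Lemma weighted_sum_le n (d : nat -> R) (D : R) :
  (forall k, (k <= n)%N -> `|d k| <= D) ->
  `|\sum_(k < n.+1) A (a - 1) (n - k) * d k| <= D * A a n.
Proof.
move=> dD; rewrite -sum_cesaro_coef_rev mulr_sumr.
rewrite (le_trans (ler_norm_sum _ _ _))//; apply: ler_sum => k _.
have c0 := cesaro_coef_gt0 a0 (n - k).
by rewrite normrM (gtr0_norm c0) mulrC ler_wpM2r ?(ltW c0)// dD// -ltnS.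
Qed.

Lemma cesaro_kernel_le n N x : (n < N)%N ->
  `|cesaro_kernel n x| <= 2 * (N%:R * N%:R `^ a).
Proof.
move=> nN.
have /(weighted_sum_le (n := n)) h :
    forall k, (k <= n)%N -> `|dirichlet R k x| <= N%:R.
  move=> k kn; rewrite (le_trans (normr_dirichlet _ _ _))// ler_nat.
  by rewrite (leq_trans kn)// ltnW.
apply: le_trans h _; rewrite [leRHS]mulrCA ler_wpM2l//.
apply: le_trans (cesaro_coef_upper a0 a1 n) _; rewrite ler_wpM2l//.
by rewrite ge0_ler_powR ?nnegrE ?ler_nat// ltW.
Qed.

(** If [x] has ones at [k < l] then, with [N = 2 ^ l.+1], the last [N] terms of
    the kernel are bounded directly, and on the others the weights increase while
    the partial sums of the Dirichlet kernels stay below [N ^ 2]. *)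
Lemma cesaro_kernel_le_ones k l n x : x k -> (k < l)%N -> x l ->
  `|cesaro_kernel n x| <= 6 * ((2 ^ l.+1)%:R * (2 ^ l.+1)%:R `^ a).
Proof.
move=> xk kl xl; set N := (2 ^ l.+1)%N.
have P0 : 0 <= N%:R * N%:R `^ a :> R by rewrite mulr_ge0// powR_ge0.
case: (ltnP n N) => nN.
  rewrite (le_trans (cesaro_kernel_le _ nN))// ler_wpM2r//; lra.
have N0 : (0 < N)%N by rewrite expn_gt0.
have ND : 2 ^+ l.+1 = N%:R :> R by rewrite /N natrX.
have AN : A a N.-1 <= 2 * N%:R `^ a by rewrite -{2}(prednK N0) cesaro_coef_upper.
have NA : N%:R * A (a - 1) N <= A a N.-1.
  rewrite -(sum_cesaro_coef a N.-1) prednK// mulr_natl -[X in _ *+ X]card_ord -sumr_const.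
  by apply: ler_sum => j _; rewrite cesaro_coef_noninc// ltnW.
(* The last [N] terms have the weights [A_(N - 1)], ..., [A_0]. *)
have -> : cesaro_kernel n x =
    \sum_(j < (n - N).+1) A (a - 1) (n - j) * dirichlet R j x +
    \sum_(i < N.-1.+1) A (a - 1) (N.-1 - i) * dirichlet R ((n - N).+1 + i) x.
  rewrite /cesaro_kernel.
  have e : n.+1 = ((n - N).+1 + N.-1.+1)%N by lia.
  rewrite e big_split_ord /=; congr (_ + _); apply: eq_bigr => i _.
  by congr (A _ _ * _); lia.
rewrite (le_trans (ler_normD _ _))//.
have h1 := @abel_bound R (fun j => A (a - 1) (n - j))
  (fun j => dirichlet R j x) (N%:R ^+ 2) (n - N).
rewrite subKn// in h1.
have h2 : `|\sum_(i < N.-1.+1) A (a - 1) (N.-1 - i) *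
    dirichlet R ((n - N).+1 + i) x| <= N%:R * A a N.-1.
  apply: (weighted_sum_le (d := fun i => dirichlet R ((n - N).+1 + i) x)) => i _.
  by rewrite -ND; apply: normr_dirichlet_le xk _; rewrite ltnW.
(* On the first terms the weights are at most [A_N]. *)
have {}h1 : `|\sum_(j < (n - N).+1) A (a - 1) (n - j) * dirichlet R j x|
    <= 2 * A (a - 1) N * N%:R ^+ 2.
  apply: h1.
  - by move=> m; rewrite -ND; exact: normr_sum_dirichlet_le xk kl xl.
  - move=> i j /andP[ij jn]; apply: cesaro_coef_noninc => //; lia.
  - exact/ltW/cesaro_coef_gt0.
have N1 : 0 <= N%:R :> R by [].
apply: le_trans (lerD h1 h2) _.
move: NA AN N1 => {P0 ND h1 h2}; move: (A a N.-1) (A (a - 1) N) (N%:R) => v w z.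
move: (z `^ a) => u NA AN z0.
have -> : 2 * w * z ^+ 2 + z * v = z * (2 * (z * w) + v) by ring.
have -> : 6 * (z * u) = z * (6 * u) by ring.
by rewrite ler_wpM2l//; lra.
Qed.

(** The group element whose only one is at position [k]; in [dyadic_interval l] it
    represents the zero cell when [l <= k]. *)
Definition coordinate_unit k : dyadic_group := fun j => j == k.

(** Either [k] and [l] are the positions of the first two ones of [y], or there is at
    most one of them below [M], at [k], with [k = M] if there is none. *)
Lemma locate_ones M y : exists k l,
  [/\ (k <= l <= M)%N, dyadic_interval l (coordinate_unit k) y &
      l = M \/ [/\ (k < l)%N, y k & y l]].
Proof.
elim: M => [|M [k [l [/andP[kl lM] yl]]]].
  by exists 0%N, 0%N; split => //; left.
move=> [lE|two]; last first.
  by exists k, l; split => //; [rewrite kl ltnW|right].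
subst l; have [yM|yM] := boolP (y M); last first.
  have yM' : y M = false by exact: negbTE.
  move: kl; rewrite leq_eqVlt => /orP[/eqP kM|kM].
    exists M.+1, M.+1; split; [by rewrite leqnn| |by left].
    move=> j; rewrite ltnS leq_eqVlt /coordinate_unit => /orP[/eqP ->|jM].
      by rewrite yM' ltn_eqF.
    by rewrite yl// /coordinate_unit kM !ltn_eqF// ltnW.
  exists k, M.+1; split; [by rewrite leqnn ltnW// ltnW| |by left].
  move=> j; rewrite ltnS leq_eqVlt => /orP[/eqP ->|]; last exact: yl.
  by rewrite yM' /coordinate_unit gtn_eqF.
move: kl; rewrite leq_eqVlt => /orP[/eqP kM|kM].
  exists M, M.+1; split; [by rewrite leqnSn leqnn| |by left].
  move=> j; rewrite ltnS leq_eqVlt /coordinate_unit => /orP[/eqP ->|jM].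
    by rewrite yM eqxx.
  by rewrite yl// /coordinate_unit kM.
exists k, M; split => //; first by rewrite ltnW// leqnSn.
by right; split => //; rewrite yl// /coordinate_unit eqxx.
Qed.

(** When [y] has at most one one below [M], the trivial bound of order
    [n ^ (1 + a)] suffices, because [n < 2 ^ M]. *)
Lemma cesaro_kernel_bound M n y : (n < 2 ^ M)%N -> exists k l,
  [/\ (k <= l <= M)%N, dyadic_interval l (coordinate_unit k) y &
      `|cesaro_kernel n y| <= 24 * (2 ^+ l) `^ (1 + a)].
Proof.
move=> nM; have [k [l [kl yl two]]] := locate_ones M y.
exists k, l; split => //.
have e2 : (2 ^+ l : R) `^ (1 + a) = 2 ^+ l * (2 ^+ l) `^ a.
  by rewrite powRD ?powRr1// gt_eqF//= ?implybT// addr_gt0.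
rewrite e2; have P0 : 0 <= 2 ^+ l * (2 ^+ l) `^ a :> R.
  by rewrite mulr_ge0// powR_ge0.
case: two => [lM|[kl' yk yl']].
  rewrite (le_trans (cesaro_kernel_le _ nM))// natrX -lM ler_wpM2r//; lra.
rewrite (le_trans (cesaro_kernel_le_ones n yk kl' yl'))//.
have -> : 24 * (2 ^+ l * (2 ^+ l) `^ a) = 6 * ((2 * 2 ^+ l) * (2 * (2 ^+ l) `^ a)) :> R.
  by ring.
rewrite ler_wpM2l// natrX exprS ler_wpM2l ?mulr_ge0// powRM//.
rewrite ler_wpM2r ?powR_ge0// -[leRHS]powRr1// ler_powR ?ler1n//; exact: ltW.
Qed.

End cesaro_kernel.

(** * Dyadic cells and integrals of functions of finitely many coordinates *)

Section dyadic_levels.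
Variable R : realType.
Implicit Types (x y : dyadic_group) (i j k l n m : nat) (A : set dyadic_group).
Local Notation mu := (haar R).

Definition cube n := {ffun 'I_n -> bool}.

(** A point of each cell: the coordinates from [n] on are set to [false]. *)
Definition cube_point n (s : cube n) : dyadic_group :=
  fun k => oapp s false (insub k).

Definition cube_proj n x : cube n := [ffun i : 'I_n => x i].

Definition cell n (s : cube n) := dyadic_interval n (cube_point s).

Lemma cube_pointE n (s : cube n) (i : 'I_n) : cube_point s i = s i.
Proof. by rewrite /cube_point valK. Qed.

Lemma cellP n (s : cube n) x : cell s x <-> cube_proj n x = s.
Proof.
split=> [xs|<- k kn].
  by apply/ffunP => i; rewrite ffunE xs// cube_pointE.
by rewrite -[k]/(nat_of_ord (Ordinal kn)) cube_pointE ffunE.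
Qed.

Lemma dyadic_interval_sym n x y : dyadic_interval n x y -> dyadic_interval n y x.
Proof. by move=> xy k kn; rewrite xy. Qed.

Lemma dyadic_interval_eq n x y : dyadic_interval n x y ->
  dyadic_interval n x = dyadic_interval n y.
Proof.
by move=> xy; apply/seteqP; split => z h k kn; rewrite h// ?xy// -?xy.
Qed.

Lemma dyadic_interval_le n m x : (n <= m)%N ->
  dyadic_interval m x `<=` dyadic_interval n x.
Proof. by move=> nm y xy k kn; rewrite xy// (leq_trans kn). Qed.

Lemma measurable_dyadic_interval n x : measurable (dyadic_interval n x).
Proof.
rewrite (_ : dyadic_interval n x =
  \bigcap_(k in [set k | (k < n)%N]) [set y | y k = x k]) //.
by apply: bigcap_measurableType => k _; apply: sub_sigma_algebra; exists k, (x k).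
Qed.

Lemma haar_dyadic_interval n x : mu (dyadic_interval n x) = (2^-1 ^+ n)%:E.
Proof.
have := haarP R n (fun k => finset.set1 (x k)).
rewrite (_ : [set _ | _] = dyadic_interval n x); last first.
  apply/seteqP; split => y h k kn; first by apply/eqP; rewrite -finset.in_set1 h.
  by rewrite h// finset.in_set1.
move=> ->; congr EFin; under eq_bigr do rewrite cards1 mul1r.
by rewrite prodr_const card_ord.
Qed.

Lemma integral_indic_interval n x :
  (\int[mu]_y (\1_(dyadic_interval n x) y)%:E = (2^-1 ^+ n)%:E)%E.
Proof.
rewrite integral_indic ?setIT//; last exact: measurable_dyadic_interval.
exact: haar_dyadic_interval.
Qed.

(** The pointwise form of measurability with respect to the [n]-th dyadic
    sigma-algebra (see [level_filtration]); the codomain is arbitrary so that it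
    applies to sets, as functions to [Prop], as well as to functions. *)
Definition level (T : Type) n (f : dyadic_group -> T) :=
  forall x y, dyadic_interval n x y -> f y = f x.

Lemma level_le (T : Type) n m (f : dyadic_group -> T) : (n <= m)%N ->
  level n f -> level m f.
Proof. by move=> nm lf x y /(dyadic_interval_le nm); exact: lf. Qed.

(** From left to right, the sets of level [n] form a sigma-algebra that contains the
    intervals; from right to left, such a set is a finite union of cells. *)
Lemma level_filtration n A : dyadic_filtration n A <-> level n (A : _ -> Prop).
Proof.
split.
  move: A; apply: smallest_sub.
    split.
    - by [].
    - by move=> A lA x y xy; rewrite /setD /mkset /= !(lA x y).
    - move=> F lF x y xy; apply/propext; split=> -[i _ Fi]; exists i => //;
      by move: Fi; rewrite (lF i x y).
  move=> _ [z _ <-] x y xy; apply/propext; split => h k kn.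
    by rewrite -xy// h.
  by rewrite xy// h.
move=> lA.
have -> : A = \bigcup_(s in [set s : cube n | A (cube_point s)]) cell s.
  apply/seteqP; split=> [x Ax|x [s /= As xs]].
    exists (cube_proj n x); last by apply/cellP.
    by rewrite /= -(lA _ x)//; apply/cellP.
  by rewrite (lA (cube_point s)).
apply: (@fin_bigcup_measurable _
    (g_sigma_algebraType (range (dyadic_interval n)))) => [|s _].
  exact: finite_finset.
by apply: sub_sigma_algebra; exists (cube_point s).
Qed.

Lemma level_measurable_set n A : level n (A : _ -> Prop) -> measurable A.
Proof.
move=> /level_filtration; apply: smallest_sub; first exact: sigma_algebra_measurable.
by move=> _ [x _ <-]; exact: measurable_dyadic_interval.
Qed.

Lemma level_measurable d (T : measurableType d) n (f : dyadic_group -> T) D :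
  level n f -> measurable D -> measurable_fun D f.
Proof.
move=> lf mD _ B mB; apply: measurableI => //; apply: (@level_measurable_set n).
by move=> x y xy; rewrite /preimage /mkset (lf x y xy).
Qed.

Lemma measurable_cell n (s : cube n) : measurable (cell s).
Proof. exact: measurable_dyadic_interval. Qed.
Hint Resolve measurable_cell : core.

Lemma setI_cells n A : A = \big[setU/set0]_(s : cube n) (A `&` cell s).
Proof.
rewrite -bigcup_seq; apply/seteqP; split=> [x Ax|x [s _ []]//].
by exists (cube_proj n x); [rewrite /= mem_index_enum|split => //; apply/cellP].
Qed.

Lemma trivIset_cells n A :
  trivIset [set` index_enum (cube n)] (fun s : cube n => A `&` cell s).
Proof. by move=> s t _ _ [x [[_ /cellP <-] [_ /cellP <-]]]. Qed.

Lemma ge0_integral_cells n A (f : dyadic_group -> \bar R) : measurable A ->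
  measurable_fun A f -> (forall x, A x -> 0 <= f x)%E ->
  (\int[mu]_(x in A) f x = \sum_(s : cube n) \int[mu]_(x in A `&` cell s) f x)%E.
Proof.
move=> mA mf f0; rewrite {1}(setI_cells n A) ge0_integral_bigsetU -?setI_cells//.
- by move=> s; exact: measurableI.
- exact: index_enum_uniq.
- exact: trivIset_cells.
Qed.

Lemma integral_cells n A (f : dyadic_group -> R) : measurable A ->
  measurable_fun A f ->
  (\int[mu]_(x in A) (f x)%:E =
    \sum_(s : cube n) \int[mu]_(x in A `&` cell s) (f x)%:E)%E.
Proof.
move=> mA mf; rewrite {1}(setI_cells n A) integral_bigsetU_EFin -?setI_cells//.
- by move=> s; exact: measurableI.
- exact: index_enum_uniq.
- exact: trivIset_cells.
- exact/measurable_EFinP.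
Qed.

Lemma haar_cell n (s : cube n) : mu (cell s) = (2^-1 ^+ n)%:E.
Proof. exact: haar_dyadic_interval. Qed.

Lemma integral_cell n (s : cube n) (f : dyadic_group -> \bar R) : level n f ->
  (\int[mu]_(x in cell s) f x = f (cube_point s) * (2^-1 ^+ n)%:E)%E.
Proof.
move=> lf; rewrite (eq_integral (cst (f (cube_point s)))).
  by rewrite integral_cst// -(haar_cell s).
by move=> x /[!inE] xs; exact: lf.
Qed.

Lemma ge0_integral_level n (f : dyadic_group -> \bar R) : level n f ->
  (forall x, 0 <= f x)%E ->
  (\int[mu]_x f x = \sum_(s : cube n) f (cube_point s) * (2^-1 ^+ n)%:E)%E.
Proof.
move=> lf f0; rewrite (ge0_integral_cells n)//; last exact: level_measurable lf _.
by apply: eq_bigr => s _; rewrite setTI integral_cell.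
Qed.

Lemma integral_level n (f : dyadic_group -> R) : level n f ->
  (\int[mu]_x (f x)%:E = (2^-1 ^+ n * \sum_(s : cube n) f (cube_point s))%:E)%E.
Proof.
move=> lf; rewrite (integral_cells n)//; last exact: level_measurable lf _.
rewrite mulr_sumr -sumEFin; apply: eq_bigr => s _; rewrite setTI.
rewrite (@integral_cell n s (EFin \o f)); last by move=> x y /lf /= ->.
by rewrite mulrC.
Qed.

Lemma level_integrable n (f : dyadic_group -> R) : level n f ->
  mu.-integrable setT (EFin \o f).
Proof.
move=> lf; apply/integrableP; split.
  by apply/measurable_EFinP; exact: level_measurable lf _.
rewrite (@integral_level n (fun x => `|f x|)) ?ltry//.
by move=> x y /lf ->.
Qed.

End dyadic_levels.

(** * Martingales and their Cesaro means *)

Section martingales.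
Variable R : realType.
Implicit Types (F : nat -> dyadic_group -> R) (x y : dyadic_group).
Implicit Types (i j k l n m M : nat).
Local Notation mu := (haar R).

Lemma martingale_level F n : martingale F -> level n (F n).
Proof.
move=> mF x y xy.
have /level_filtration/(_ x y xy) :=
  @martingale_adapted _ _ mF n _ (measurable_set1 (F n x)).
by rewrite /preimage /mkset /= => e; rewrite e.
Qed.

(** The limit that defines the coefficient is that of an eventually constant
    sequence: [w_k] is constant on the cells of level [M], and on each of them [F_n]
    has the same integral as [F_M] if [n >= M]. *)
Lemma walsh_coefE F k M : martingale F -> (k < 2 ^ M)%N ->
  walsh_coef F k =
    2^-1 ^+ M * \sum_(s : cube M) F M (cube_point s) * walsh R k (cube_point s).
Proof.
move=> mF kM; apply: lim_near_cst => //; near=> n.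
have Mn : (M <= n)%N by near: n; exact: nbhs_infty_ge.
have lw : level M (walsh R k) by move=> x y; exact: walsh_low.
have iF := martingale_integrable mF n.
have mFn : measurable_fun setT (F n) by have /integrableP[/measurable_EFinP] := iF.
rewrite /Rintegral (integral_cells M)//; last first.
  by apply: measurable_funM => //; exact: level_measurable lw _.
rewrite mulr_sumr (eq_bigr (fun s : cube M => (2^-1 ^+ M *
    (F M (cube_point s) * walsh R k (cube_point s)))%:E)) ?sumEFin// => s _.
rewrite setTI (eq_integral (fun x => ((F n x)%:E * (walsh R k (cube_point s))%:E)%E)).
  rewrite integralZr//; last first.
  - by apply: integrableS iF => //; exact: measurable_cell.
  - exact: measurable_cell.
  rewrite (martingale_condexp mF Mn); last by apply: sub_sigma_algebra; exists (cube_point s).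
  rewrite (@integral_cell R M s (EFin \o F M)); last first.
    by move=> x y /(martingale_level mF) /= ->.
  by rewrite -!EFinM; congr EFin; ring.
by move=> x /[!inE] xs; rewrite EFinM (lw (cube_point s) x).
Unshelve. all: by end_near. Qed.

Lemma partial_sumE F k M x : martingale F -> (k <= 2 ^ M)%N ->
  partial_sum k F x = 2^-1 ^+ M *
    \sum_(s : cube M) F M (cube_point s) * dirichlet R k (dyadic_add (cube_point s) x).
Proof.
move=> mF kM; rewrite /partial_sum mulr_sumr.
under eq_bigr => j _.
  rewrite (walsh_coefE mF (leq_trans (ltn_ord j) kM)) mulr_sumr mulr_suml.
  over.
rewrite exchange_big /=; apply: eq_bigr => s _.
rewrite /dirichlet !mulr_sumr; apply: eq_bigr => j _.
by rewrite walsh_add; ring.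
Qed.

Lemma cesaro_meanE a F n M x : martingale F -> (n < 2 ^ M)%N ->
  cesaro_mean a n F x = (cesaro_coef a n)^-1 * (2^-1 ^+ M *
    \sum_(s : cube M) F M (cube_point s) *
      cesaro_kernel a n (dyadic_add (cube_point s) x)).
Proof.
move=> mF nM; rewrite /cesaro_mean; congr (_ * _).
pose f k := cesaro_coef (a - 1) (n - k) * partial_sum k F x.
have -> : \sum_(1 <= k < n.+1) f k = \sum_(k < n.+1) f k.
  rewrite -(big_mkord xpredT f) [in RHS]big_ltn//.
  by rewrite /f /partial_sum big_ord0 mulr0 add0r.
under eq_bigr => k _.
  rewrite /f (@partial_sumE F k M)//; last exact: ltnW (leq_trans (ltn_ord k) nM).
  rewrite mulr_sumr mulr_sumr; over.
rewrite exchange_big mulr_sumr /=; apply: eq_bigr => s _.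
by rewrite /cesaro_kernel !mulr_sumr; apply: eq_bigr => k _; ring.
Qed.

Lemma cesaro_mean_level a F n : level n (cesaro_mean a n F).
Proof.
move=> x y xy; rewrite /cesaro_mean; congr (_ * _).
apply: eq_big_nat => k /andP[_ kn]; congr (_ * _).
apply: eq_bigr => j _; congr (_ * _); apply: walsh_low xy.
apply: leq_ltn_trans (ltn_expl n (ltnSn 1)); rewrite -ltnS.
exact: ltn_trans (ltn_ord j) kn.
Qed.

Lemma measurable_ereal_sup_image d (T : measurableType d) (D : set nat)
    (f : nat -> T -> \bar R) : (forall n, measurable_fun setT (f n)) ->
  measurable_fun setT (fun z => ereal_sup [set f n z | n in D]).
Proof.
move=> mf mT; apply: (measurability _ (ErealGenOInfty.measurableE R)) => //.
move=> _ [_ [r ->] <-]; rewrite setTI.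
rewrite (_ : _ @^-1` _ = \bigcup_(n in D) (f n @^-1` `]r%:E, +oo[)).
  apply: bigcup_measurable => n _; rewrite -[X in measurable X]setTI.
  exact/mf/emeasurable_itv.
apply/seteqP; split=> z /=; rewrite in_itv /= andbT.
  by move=> /ereal_sup_gt[_ [n Dn <-] h]; exists n => //=; rewrite in_itv /= andbT.
move=> [n Dn /=]; rewrite in_itv /= andbT => /lt_le_trans; apply.
by apply: ereal_sup_ubound; exists n.
Qed.

Lemma measurable_maximal_function F : martingale F ->
  measurable_fun setT (maximal_function F).
Proof.
move=> mF; apply: (@measurable_ereal_sup_image _ _ setT (fun n x => `|F n x|%:E)) => n.
apply/measurable_EFinP; apply: measurableT_comp => //.
by apply: level_measurable (martingale_level mF) _.
Qed.

Lemma measurable_weighted_maximal a (D : set nat) w F :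
  measurable_fun setT (weighted_maximal a D w F).
Proof.
apply: (@measurable_ereal_sup_image _ _ D
  (fun n x => (`|cesaro_mean a n F x| / w n)%:E)) => n.
apply/measurable_EFinP; apply: (@level_measurable _ _ n) => //.
by move=> x y /cesaro_mean_level ->.
Qed.

End martingales.

(** * Translation by one coordinate *)

Section coordinate_flips.
Variable R : realType.
Implicit Types (x y : dyadic_group) (j k l : nat).
Local Notation mu := (haar R).

Definition flip k x : dyadic_group := dyadic_add (coordinate_unit k) x.

Lemma flipK k : involutive (flip k).
Proof. by move=> x; apply/funext => j; rewrite /flip /dyadic_add addKb. Qed.

Lemma flip_interval k l x y :
  dyadic_interval l x y -> dyadic_interval l (flip k x) (flip k y).
Proof. by move=> xy j jl; rewrite /flip /dyadic_add xy. Qed.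

Lemma dyadic_add_interval k l x y :
  dyadic_interval l (coordinate_unit k) (dyadic_add y x) ->
  dyadic_interval l (flip k x) y.
Proof.
by move=> h j jl; rewrite /flip /dyadic_add -h// /dyadic_add addbK.
Qed.

(** Translation by [coordinate_unit k] as a permutation of the cells of level [l]; it
    is the identity when [l <= k]. *)
Definition cube_flip k l (s : cube l) : cube l := cube_proj l (flip k (cube_point s)).

Lemma cube_flip_interval k l (s : cube l) :
  dyadic_interval l (cube_point (cube_flip k s)) (flip k (cube_point s)).
Proof. exact/cellP. Qed.

Lemma cell_cube_flip k l (s : cube l) :
  cell (cube_flip k s) = dyadic_interval l (flip k (cube_point s)).
Proof. exact: dyadic_interval_eq (cube_flip_interval k s). Qed.

Lemma cube_flipK k l : involutive (@cube_flip k l).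
Proof.
move=> s; apply/cellP; apply: dyadic_interval_sym.
rewrite -[X in dyadic_interval _ _ X](flipK k).
exact: flip_interval (cube_flip_interval k s).
Qed.

(** The inner integral depends only on the cell of [x], and the translation permutes
    the cells of level [l]. *)
Lemma integral_flip_interval (g : dyadic_group -> \bar R) k l :
  measurable_fun setT g -> (forall x, 0 <= g x)%E ->
  (\int[mu]_x \int[mu]_(t in dyadic_interval l (flip k x)) g t =
    (2^-1 ^+ l)%:E * \int[mu]_x g x)%E.
Proof.
move=> mg g0; rewrite (@ge0_integral_level R l); last 2 first.
- by move=> x y /(flip_interval k)/dyadic_interval_eq ->.
- by move=> x; exact: integral_ge0.
rewrite -ge0_sume_distrl; last by move=> s _; exact: integral_ge0.
rewrite muleC; congr (_ * _)%E.
rewrite (ge0_integral_cells l)// [RHS](reindex_inj (inv_inj (@cube_flipK k l))) /=.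
by apply: eq_bigr => s _; rewrite setTI cell_cube_flip.
Qed.


Lemma sum_cube_flip_opp k l (g : dyadic_group -> R) : level l g ->
  (forall x, g (flip k x) = - g x) -> \sum_(s : cube l) g (cube_point s) = 0.
Proof.
move=> lg gN; set S := LHS.
have SN : S = - S.
  rewrite {1}/S (reindex_inj (inv_inj (@cube_flipK k l))) /= -sumrN.
  apply: eq_bigr => s _; rewrite -gN; apply/esym/lg; exact: cube_flip_interval.
by apply/eqP; rewrite -[_ == _](mulrn_eq0 S 2) mulr2n {1}SN addNr.
Qed.

End coordinate_flips.

(** * Boundedness of the weighted maximal operator *)

Section maximal_inequality.
Variables (R : realType) (a p : R).
Hypotheses (a0 : 0 < a) (a1 : a < 1) (p0 : 0 < p) (pa1 : p * (1 + a) < 1).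
Implicit Types (F : nat -> dyadic_group -> R) (x y : dyadic_group).
Implicit Types (i j k l n m M : nat).
Local Notation mu := (haar R).

Let p1 : p < 1.
Proof. by rewrite (le_lt_trans _ pa1)// ler_peMr ?(ltW p0)// lerDl ltW. Qed.

(** Bounds the [p]-th power of the kernel bound; [24 ^ p <= 24]. *)
Definition weight l : R := 24 * (2 ^+ l) `^ (p * (1 + a)).

Lemma weight_ge0 l : 0 <= weight l.
Proof. by rewrite mulr_ge0// powR_ge0. Qed.

Lemma pow_cesaro_kernel_bound M n y : (n < 2 ^ M)%N -> exists k l,
  [/\ (k <= l <= M)%N, dyadic_interval l (coordinate_unit k) y &
      `|cesaro_kernel a n y| `^ p <= weight l].
Proof.
move=> nM; have [k [l [klM yl Kl]]] := cesaro_kernel_bound a0 a1 y nM.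
exists k, l; split => //.
have : `|cesaro_kernel a n y| `^ p <= (24 * (2 ^+ l) `^ (1 + a)) `^ p.
  by rewrite ge0_ler_powR ?nnegrE ?(ltW p0)// (le_trans _ Kl).
move=> /le_trans; apply.
rewrite powRM ?powR_ge0// -powRrM (mulrC _ p) ler_wpM2r ?powR_ge0//.
by rewrite -[leRHS]powRr1// ler_powR ?ler1n// ltW.
Qed.

(** The convolution of the [p]-th power of the maximal function with [weight l] times
    the indicators of the intervals of length [2 ^ -l] that contain the points with at
    most one one below [l].  For [k = l] the flip leaves the interval unchanged. *)
Definition majorant_block F l x : \bar R :=
  (\sum_(k < l.+1) (weight l)%:E *
     \int[mu]_(t in dyadic_interval l (flip k x)) maximal_function F t `^ p)%E.

Definition majorant F x : \bar R := (\sum_(l <oo) majorant_block F l x)%E.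

Lemma majorant_block_level F l : level l (majorant_block F l).
Proof.
move=> x y xy; apply: eq_bigr => k _.
by rewrite (dyadic_interval_eq (flip_interval k xy)).
Qed.

Lemma majorant_block_ge0 F l x : (0 <= majorant_block F l x)%E.
Proof.
apply: sume_ge0 => k _; rewrite mule_ge0 ?lee_fin ?weight_ge0// integral_ge0// => t _.
exact: poweR_ge0.
Qed.

Lemma majorant_ge0 F x : (0 <= majorant F x)%E.
Proof. by apply: nneseries_ge0 => l _ _; exact: majorant_block_ge0. Qed.

Lemma measurable_majorant F : measurable_fun setT (majorant F).
Proof.
apply: (ge0_emeasurable_sum (P := xpredT)) => [l x _ _|l _].
  exact: majorant_block_ge0.
exact: level_measurable (@majorant_block_level F l) _.
Qed.

Lemma maximal_function_ge F n x : (`|F n x|%:E <= maximal_function F x)%E.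
Proof. by apply: ereal_sup_ubound; exists n. Qed.

Lemma maximal_function_ge0 F x : (0 <= maximal_function F x)%E.
Proof. by apply: le_trans (maximal_function_ge F 0 x); rewrite lee_fin. Qed.

Lemma measurable_pow_maximal F : martingale F ->
  measurable_fun setT (fun t => maximal_function F t `^ p)%E.
Proof.
move=> mF; apply: (measurableT_comp (measurable_poweR p)).
exact: measurable_maximal_function.
Qed.

(** Both [F_M] and the kernel are constant on the cell [s], which has measure
    [2 ^ -M]; rewriting [(2 ^ -M) ^ p] as [2 ^ (M (1 - p)) 2 ^ -M] turns the [p]-th
    power of the value of [F_M] into an integral over the cell.  The right-hand side
    sums over all [k] and [l], though a single pair depending on [s] and [x] is
    enough, in order to allow the summation over [s]. *)
Lemma summand_le F M n x (s : cube M) : martingale F -> (n < 2 ^ M)%N ->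
  ((`|2^-1 ^+ M * (F M (cube_point s) *
       cesaro_kernel a n (dyadic_add (cube_point s) x))| `^ p)%:E <=
   ((2 ^+ M) `^ (1 - p))%:E * \sum_(l < M.+1) \sum_(k < l.+1) (weight l)%:E *
     \int[mu]_(t in dyadic_interval l (flip k x) `&` cell s)
       maximal_function F t `^ p)%E.
Proof.
move=> mF nM; set P : dyadic_group -> \bar R := fun t => (maximal_function F t `^ p)%E.
have P0 t : (0 <= P t)%E by exact: poweR_ge0.
have mP := measurable_pow_maximal mF.
have [k [l [/andP[kl lM] sl Kl]]] := pow_cesaro_kernel_bound
  (dyadic_add (cube_point s) x) nM.
have term0 i j : (0 <= (weight j)%:E * \int[mu]_(t in dyadic_interval j (flip i x)
    `&` cell s) P t)%E.
  by rewrite mule_ge0 ?lee_fin ?weight_ge0// integral_ge0.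
have cellS : cell s `<=` dyadic_interval l (flip k x).
  move=> t st j jl; rewrite (st j (leq_trans jl lM)).
  exact: dyadic_add_interval sl _ jl.
have intP : ((2^-1 ^+ M * `|F M (cube_point s)| `^ p)%:E <=
    \int[mu]_(t in dyadic_interval l (flip k x) `&` cell s) P t)%E.
  rewrite (setIidr cellS) mulrC EFinM.
  have lF : level M (fun t => (`|F M t| `^ p)%:E).
    by move=> u v /(martingale_level mF) ->.
  have <- := integral_cell s lF; apply: ge0_le_integral => //.
  - exact: measurable_cell.
  - by apply: level_measurable lF _; exact: measurable_cell.
  - exact: measurable_funS mP.
  - move=> t _; rewrite -poweR_EFin; apply: gt0_ler_poweR => //.
    + exact: ltW.
    + by rewrite in_itv /= lee_fin normr_ge0 leey.
    + by rewrite in_itv /= maximal_function_ge0 leey.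
    + exact: maximal_function_ge.
have e2 : (2^-1 ^+ M : R) `^ p = (2 ^+ M) `^ (1 - p) * 2^-1 ^+ M.
  have M0 : (2 ^+ M : R) != 0 by rewrite expf_neq0.
  rewrite powRB ?M0 ?implybT// powRr1// exprVn -powR_inv1// -powRrM mulN1r powRN.
  by rewrite powR_inv1// mulrAC divff// mul1r.
apply: (@le_trans _ _ (((2 ^+ M) `^ (1 - p))%:E *
    ((weight l)%:E * (2^-1 ^+ M * `|F M (cube_point s)| `^ p)%:E))%E).
  rewrite -!EFinM lee_fin !normrM !powRM ?mulr_ge0//.
  rewrite ger0_norm ?exprn_ge0// e2 -mulrA ler_wpM2l ?powR_ge0//.
  rewrite [leRHS]mulrC mulrA ler_wpM2l// mulr_ge0 ?powR_ge0// exprn_ge0//.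
rewrite lee_pmul2l// ?lte_fin ?powR_gt0 ?exprn_gt0//.
apply: (@le_trans _ _ ((weight l)%:E * \int[mu]_(t in dyadic_interval l (flip k x)
    `&` cell s) P t)%E).
  by rewrite lee_wpmul2l// lee_fin weight_ge0.
rewrite (bigD1 (Ordinal (lM : (l < M.+1)%N)))//=.
rewrite (bigD1 (Ordinal (kl : (k < l.+1)%N)))//= -addeA leeDl//.
by rewrite adde_ge0 ?sume_ge0// => j _; rewrite sume_ge0.
Qed.

Lemma kernel_sum_le_majorant F M n x : martingale F -> (n < 2 ^ M)%N ->
  ((`|2^-1 ^+ M * \sum_(s : cube M) F M (cube_point s) *
      cesaro_kernel a n (dyadic_add (cube_point s) x)| `^ p)%:E <=
   ((2 ^+ M) `^ (1 - p))%:E * majorant F x)%E.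
Proof.
move=> mF nM.
have mP := measurable_pow_maximal mF.
have B0 : (0 <= ((2 ^+ M : R) `^ (1 - p))%:E)%E by rewrite lee_fin powR_ge0.
apply: (@le_trans _ _ (\sum_(s : cube M) `|2^-1 ^+ M * (F M (cube_point s) *
       cesaro_kernel a n (dyadic_add (cube_point s) x))| `^ p)%:E).
  rewrite lee_fin mulr_sumr; apply: le_trans (powR_sum_le _ _ _) => //.
    by rewrite ge0_ler_powR ?nnegrE ?(ltW p0) ?sumr_ge0// ler_norm_sum.
  by rewrite p0 ltW.
rewrite -sumEFin.
apply: le_trans (lee_sum _ (fun s _ => summand_le x s mF nM)) _.
have term0 (A : set dyadic_group) j : (0 <= (weight j)%:E * \int[mu]_(t in A)
    maximal_function F t `^ p)%E.
  by rewrite mule_ge0 ?lee_fin ?weight_ge0// integral_ge0// => t _; exact: poweR_ge0.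
rewrite -ge0_sume_distrr; last first.
  by move=> s _; apply: sume_ge0 => l _; apply: sume_ge0.
rewrite lee_wpmul2l// exchange_big /=.
under eq_bigr do rewrite exchange_big /=.
rewrite /majorant; apply: le_trans; last first.
  by apply: (nneseries_lim_ge M.+1) => l _ _; exact: majorant_block_ge0.
rewrite big_mkord le_eqVlt; apply/orP; left; apply/eqP.
apply: eq_bigr => l _; apply: eq_bigr => k _.
rewrite -ge0_sume_distrr; last first.
  by move=> s _; apply: integral_ge0 => t _; exact: poweR_ge0.
congr (_ * _)%E; rewrite -ge0_integral_cells//.
- exact: measurable_dyadic_interval.
- exact: measurable_funS mP.
- by move=> t _; exact: poweR_ge0.
Qed.

(** The partial sums of the derivative of the geometric series. *)
Lemma sum_arith_geom_le (r : R) n : 0 <= r < 1 ->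
  \sum_(0 <= l < n) l.+1%:R * r ^+ l <= (1 - r) ^- 2.
Proof.
move=> /andP[r0 r1]; have d0 : 0 < 1 - r by rewrite subr_gt0.
have e : (1 - r) ^+ 2 * (\sum_(0 <= l < n) l.+1%:R * r ^+ l) =
    1 - n.+1%:R * r ^+ n + n%:R * r ^+ n.+1.
  elim: n => [|n IH].
    by rewrite big_geq// mulr0 mul0r addr0 expr0 mulr1 subrr.
  by rewrite big_nat_recr//= mulrDr IH -!natr1 !exprS; ring.
rewrite -[leLHS]mul1r -[X in X * _ <= _](mulVf (lt0r_neq0 (exprn_gt0 2 d0))).
rewrite -mulrA e ler_piMr ?invr_ge0 ?exprn_ge0 ?(ltW d0)//.
have rn : 0 <= r ^+ n by rewrite exprn_ge0.
rewrite -subr_ge0.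
have -> : 1 - (1 - n.+1%:R * r ^+ n + n%:R * r ^+ n.+1) =
    n%:R * (r ^+ n * (1 - r)) + r ^+ n by rewrite exprS -natr1; ring.
by rewrite addr_ge0// !mulr_ge0// ltW.
Qed.

(** [weight l], multiplied by the length [2 ^ -l] of the intervals, is
    [24 * ratio ^ l]. *)
Definition ratio : R := (2 : R) `^ (p * (1 + a) - 1).

Lemma ratio01 : 0 <= ratio < 1.
Proof.
rewrite /ratio powR_ge0 /= lt_neqAle; apply/andP; split.
  by rewrite powR_eq1 !negb_or subr_eq0 (lt_eqF pa1) -leNgt ler0n pnatr_eq1.
by rewrite -[leRHS](powRr0 2) ler_powR ?ler1n// subr_le0 ltW.
Qed.


Definition majorant_const : R := 24 * (1 - ratio) ^- 2.

Lemma majorant_const_ge0 : 0 <= majorant_const.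
Proof. by rewrite mulr_ge0// invr_ge0 sqr_ge0. Qed.

Lemma integral_majorant_le F : martingale F ->
  (\int[mu]_x majorant F x <=
    majorant_const%:E * \int[mu]_x maximal_function F x `^ p)%E.
Proof.
move=> mF; set P : dyadic_group -> \bar R := fun t => (maximal_function F t `^ p)%E.
have P0 t : (0 <= P t)%E by exact: poweR_ge0.
have mP := measurable_pow_maximal mF.
have level_term k l : level l (fun x =>
    ((weight l)%:E * \int[mu]_(t in dyadic_interval l (flip k x)) P t)%E).
  by move=> x y /(flip_interval k)/dyadic_interval_eq ->.
have term0 k l x : (0 <= (weight l)%:E *
    \int[mu]_(t in dyadic_interval l (flip k x)) P t)%E.
  by rewrite mule_ge0 ?lee_fin ?weight_ge0// integral_ge0.
rewrite /majorant integral_nneseries//; last 2 first.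
- by move=> l; exact: level_measurable (@majorant_block_level F l) _.
- by move=> l x _; exact: majorant_block_ge0.
apply: lime_le.
  apply: is_cvg_nneseries => l _ _; apply: integral_ge0 => x _.
  exact: majorant_block_ge0.
apply: nearW => N.
have termE l : (\int[mu]_x majorant_block F l x =
    (24 * (l.+1%:R * ratio ^+ l))%:E * \int[mu]_x P x)%E.
  rewrite ge0_integral_sum//; last first.
    by move=> k; exact: level_measurable (level_term k l) _.
  rewrite (eq_bigr (fun=> (weight l * 2^-1 ^+ l)%:E * \int[mu]_x P x)%E); last first.
    move=> k _; rewrite ge0_integralZl_EFin ?weight_ge0//.
    - by rewrite integral_flip_interval// muleA -EFinM.
    - by move=> x _; apply: integral_ge0 => t _; exact: P0.
    - apply: (@level_measurable _ _ l) => //.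
      by move=> x y /(flip_interval k)/dyadic_interval_eq ->.
  rewrite -ge0_sume_distrl; last first.
    by move=> k _; rewrite lee_fin mulr_ge0 ?weight_ge0// exprn_ge0.
  have -> : ratio ^+ l = (2 ^+ l) `^ (p * (1 + a)) * 2^-1 ^+ l.
    rewrite /ratio exprVn -powR_mulrn ?powR_ge0// -!powR_mulrn// -!powRrM -powRN.
    by rewrite -powRD ?pnatr_eq0 ?implybT//; congr (_ `^ _); ring.
  rewrite sumEFin sumr_const card_ord -[_ *+ l.+1]mulr_natl /weight.
  by congr (_%:E * _)%E; ring.
under eq_bigr do rewrite termE.
rewrite -ge0_sume_distrl; last first.
  move=> l _; rewrite lee_fin !mulr_ge0// exprn_ge0//; by case/andP: ratio01.
rewrite sumEFin lee_wpmul2r ?integral_ge0// lee_fin -mulr_sumr ler_wpM2l//.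
exact: sum_arith_geom_le ratio01.
Qed.

(** The level [M] is chosen with [2 ^ M] between [n + 1] and [2 (n + 1)], whence the
    factor [2 ^ (1 - p) <= 2]. *)
Lemma cesaro_mean_le_majorant F n x : martingale F ->
  (((`|cesaro_mean a n F x| / (n%:R + 1) `^ (1 / p - 1 - a)) `^ p)%:E <=
    2%:E * majorant F x)%E.
Proof.
move=> mF; set M := (trunc_log 2 n.+1).+1.
have nM : (n.+1 < 2 ^ M)%N by exact: trunc_log_ltn.
have Mn : (2 ^ M <= 2 * n.+1)%N by rewrite expnS leq_mul2l/= trunc_logP.
have n0 : 0 < n.+1%:R :> R by [].
have maj0 := majorant_ge0 F x.
rewrite natr1 (cesaro_meanE a x mF (ltnW nM)).
have := kernel_sum_le_majorant x mF (ltnW nM).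
set T := (X in `|X| `^ p) => Tle.
have A0 : 0 < n.+1%:R `^ a :> R by rewrite powR_gt0.
have le1 : `|(cesaro_coef a n)^-1 * T| / n.+1%:R `^ (1 / p - 1 - a) <=
    n.+1%:R `^ (- (1 / p - 1)) * `|T|.
  have -> : n.+1%:R `^ (- (1 / p - 1)) =
      (n.+1%:R `^ a)^-1 * (n.+1%:R `^ (1 / p - 1 - a))^-1 :> R.
    rewrite -!powRN -powRD; last by rewrite (gt_eqF n0) /= implybT.
    by congr (_ `^ _); ring.
  rewrite mulrAC ler_wpM2r ?invr_ge0 ?powR_ge0// normrM ler_wpM2r//.
  have C0 := lt_le_trans A0 (cesaro_coef_lower a0 a1 n).
  rewrite gtr0_norm ?invr_gt0// lef_pV2 ?posrE//.
  exact: cesaro_coef_lower.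
apply: (@le_trans _ _ ((n.+1%:R `^ (p - 1))%:E * (`|T| `^ p)%:E)%E).
  rewrite -EFinM lee_fin.
  apply: (@le_trans _ _ ((n.+1%:R `^ (- (1 / p - 1)) * `|T|) `^ p)).
    apply: ge0_ler_powR le1; rewrite ?nnegrE.
    - exact: ltW.
    - by rewrite divr_ge0 ?powR_ge0.
    - by rewrite mulr_ge0 ?powR_ge0.
  rewrite powRM ?powR_ge0// -powRrM.
  suff -> : - (1 / p - 1) * p = p - 1 by [].
  by field; rewrite gt_eqF.
apply: le_trans (lee_wpmul2l _ Tle) _; first by rewrite lee_fin powR_ge0.
rewrite muleA -EFinM lee_wpmul2r// lee_fin.
have -> : p - 1 = - (1 - p) by ring.
rewrite powRN mulrC ler_pdivrMr ?powR_gt0//.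
have q0 : 0 <= 1 - p by rewrite subr_ge0 ltW.
apply: (@le_trans _ _ ((2 * n.+1%:R) `^ (1 - p))).
  by rewrite ge0_ler_powR ?nnegrE ?mulr_ge0 ?exprn_ge0// -natrX -natrM ler_nat.
rewrite powRM// ler_wpM2r ?powR_ge0// -[leRHS]powRr1// ler_powR ?ler1n//.
by rewrite gerBl ltW.
Qed.

Lemma weighted_maximal_bounded F : martingale F ->
  ('N[mu]_p%:E[weighted_maximal a setT
          (fun n => (n%:R + 1) `^ (1 / p - 1 - a))%R F]
        <= ((2 * majorant_const) `^ p^-1)%:E * hardy_norm p F)%E.
Proof.
move=> mF; rewrite /hardy_norm unlock /Lnorm.
under [in leRHS]eq_integral do rewrite gee0_abs ?maximal_function_ge0//.
have b0 : (0 <= (2 * majorant_const)%:E)%E by rewrite lee_fin mulr_ge0 ?majorant_const_ge0.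
have I0 : (0 <= \int[mu]_x maximal_function F x `^ p)%E.
  by apply: integral_ge0 => x _; exact: poweR_ge0.
rewrite -poweR_EFin -poweRM; last 2 first.
- exact: b0.
- exact: I0.
set w : nat -> R := fun n : nat => (n%:R + 1) `^ (1 / p - 1 - a).
have maj0 := majorant_ge0 F.
have w0 x : (0 <= weighted_maximal a setT w F x)%E.
  apply: (@le_trans _ _ (`|cesaro_mean a 0 F x| / w 0%N)%:E).
    by rewrite lee_fin divr_ge0// powR_ge0.
  by apply: ereal_sup_ubound; exists 0%N.
have mmaj := measurable_majorant F.
apply: gt0_ler_poweR.
- by rewrite invr_ge0 ltW.
- rewrite in_itv /= leey andbT integral_ge0// => x _; exact: poweR_ge0.
- by rewrite in_itv /= leey andbT mule_ge0.
rewrite EFinM -muleA; apply: le_trans (lee_wpmul2l _ (integral_majorant_le mF)) => //.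
rewrite -ge0_integralZl_EFin//.
apply: ge0_le_integral => //.
- by move=> x _; exact: poweR_ge0.
- apply: (measurableT_comp (measurable_poweR p)); apply: measurableT_comp => //.
  exact: measurable_weighted_maximal.
- exact: measurable_funeM.
move=> x _; rewrite gee0_abs//.
have -> : (2%:E * majorant F x = ((2%:E * majorant F x) `^ p^-1) `^ p)%E.
  by rewrite -poweRrM mulVf ?gt_eqF// poweRe1// mule_ge0.
apply: gt0_ler_poweR; rewrite ?in_itv/= ?leey ?w0 ?poweR_ge0 ?(ltW p0)//.
apply: ub_ereal_sup => _ [n _ <-].
set v := (_ / _); have v0 : 0 <= v by rewrite divr_ge0// powR_ge0.
have -> : v%:E = ((v%:E `^ p) `^ p^-1)%E.
  by rewrite -poweRrM mulfV ?gt_eqF// poweRe1.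
apply: gt0_ler_poweR; rewrite ?in_itv/= ?leey ?poweR_ge0 ?mule_ge0 ?invr_ge0 ?(ltW p0)//.
  by rewrite lee_fin powR_ge0.
exact: cesaro_mean_le_majorant.
Qed.

End maximal_inequality.

(** * Sharpness of the weight *)

Section counterexample.
Variable R : realType.
Implicit Types (x y : dyadic_group) (j k l n m N : nat).
Local Notation mu := (haar R).

Definition zero_sequence : dyadic_group := fun=> false.

Lemma dirichlet_pow2E N x :
  dirichlet R (2 ^ N) x = 2 ^+ N * \1_(dyadic_interval N zero_sequence) x.
Proof.
rewrite indicE; have [xN|xN] := pselect (dyadic_interval N zero_sequence x).
  by rewrite mem_set// mulr1; apply: dirichlet_pow2 => k kN; rewrite xN.
rewrite memNset// mulr0.
move/existsNP: xN => [k /not_implyP[kN xk]].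
by apply: dirichlet_pow2_eq0 kN; move: xk; rewrite /zero_sequence; case: (x k).
Qed.

Lemma dirichlet_level N : level N (dirichlet R (2 ^ N)).
Proof.
by move=> x y xy; apply: eq_bigr => j _; apply: walsh_low xy.
Qed.

Definition block N x : R := rademacher R N x * dirichlet R (2 ^ N) x.

(** The martingale of [block N], which has mean zero on the cells of level [N]. *)
Definition block_martingale N n x : R := if (n <= N)%N then 0 else block N x.

Lemma block_level N : level N.+1 (block N).
Proof.
move=> x y xy; rewrite /block /rademacher xy//; congr (_ * _).
by apply: dirichlet_level; apply: dyadic_interval_le xy.
Qed.

(** This antisymmetry makes the integral of [block N] vanish on every set that depends
    on the first [N] coordinates only. *)
Lemma block_flip N x : block N (flip N x) = - block N x.
Proof.
rewrite /block (dirichlet_level (x := x)); last first.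
  by move=> k kN; rewrite /flip /dyadic_add /coordinate_unit ltn_eqF.
rewrite /rademacher /flip /dyadic_add /coordinate_unit eqxx signr_addb.
by rewrite expr1 mulN1r mulNr.
Qed.

Lemma block_martingale_level N n : level n (block_martingale N n).
Proof.
rewrite /block_martingale; case: (leqP n N) => // Nn.
exact: level_le Nn (@block_level N).
Qed.

Lemma block_martingaleP N : martingale (block_martingale N).
Proof.
split.
- move=> n B _; apply/level_filtration => x y xy.
  by rewrite /preimage /mkset (block_martingale_level N xy).
- by move=> n; apply: level_integrable (@block_martingale_level N n).
move=> m n A mn /level_filtration lA; rewrite /block_martingale.
case: (leqP m N) => mN; last by rewrite leqNgt (leq_trans mN mn).
case: (leqP n N) => nN //.
rewrite integral0 integral_mkcond.
pose g := (block N) \_ A.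
have lg : level N.+1 g.
  move=> x y xy; rewrite /g /patch (block_level xy).
  have /(lA _ _) AE := dyadic_interval_le (leqW mN) xy.
  by rewrite (_ : (y \in A) = (x \in A))//; apply/idP/idP; rewrite !inE AE.
rewrite (eq_integral (fun x => (g x)%:E)); last first.
  by move=> x _; rewrite /g /patch; case: ifP.
rewrite (integral_level lg) (@sum_cube_flip_opp R N) ?mulr0// => x.
rewrite /g /patch block_flip.
have AE : A (flip N x) = A x.
  apply: lA => k km; rewrite /flip /dyadic_add /coordinate_unit ltn_eqF//.
  exact: leq_trans km mN.
rewrite (_ : (flip N x \in A) = (x \in A)); last by apply/idP/idP; rewrite !inE AE.
by case: ifP; rewrite ?oppr0.
Qed.

Lemma walsh_coef_block_lt N k : (k < 2 ^ N)%N -> walsh_coef (block_martingale N) k = 0.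
Proof.
move=> kN; rewrite (walsh_coefE (block_martingaleP N) kN) big1 ?mulr0// => s _.
by rewrite /block_martingale leqnn mul0r.
Qed.

Lemma walsh_coef_block N : walsh_coef (block_martingale N) (2 ^ N) = 1.
Proof.
have N2 : (2 ^ N < 2 ^ N.+1)%N by rewrite ltn_exp2l.
rewrite (walsh_coefE (block_martingaleP N) N2).
under eq_bigr => s _.
  rewrite /block_martingale ltnn walsh_pow2 /block mulrAC rademacher_sqr mul1r; over.
apply: EFin_inj; rewrite -(integral_level (level_le (leqnSn N) (@dirichlet_level N))).
under eq_integral do rewrite dirichlet_pow2E EFinM.
have mI := measurable_dyadic_interval N zero_sequence.
rewrite ge0_integralZl_EFin//; last exact/measurable_EFinP/measurable_indic.
by rewrite integral_indic_interval -EFinM -exprMn divff// expr1n.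
Qed.

Lemma cesaro_mean_block a N x : cesaro_mean a (2 ^ N).+1 (block_martingale N) x =
  (cesaro_coef a (2 ^ N).+1)^-1 * rademacher R N x.
Proof.
have S0 k : (k <= 2 ^ N)%N -> partial_sum k (block_martingale N) x = 0.
  move=> kN; rewrite /partial_sum big1// => j _.
  by rewrite walsh_coef_block_lt ?mul0r// (leq_trans (ltn_ord j)).
rewrite /cesaro_mean big_nat_recr//= big_nat big1 ?add0r; last first.
  by move=> k /andP[_ kN]; rewrite S0 ?mulr0.
rewrite subnn cesaro_coef0 mul1r /partial_sum big_ord_recr /=.
by rewrite -/(partial_sum _ _ _) S0// add0r walsh_coef_block mul1r walsh_pow2.
Qed.

Lemma hardy_norm_block (p : R) N : 0 < p ->
  (hardy_norm p (block_martingale N) <= ((2 ^+ N) `^ (1 - 1 / p))%:E)%E.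
Proof.
move=> p0; have mI := measurable_dyadic_interval N zero_sequence.
have N0 : 0 < 2 ^+ N :> R by rewrite exprn_gt0.
have max_le x : (maximal_function (block_martingale N) x <=
    (2 ^+ N * \1_(dyadic_interval N zero_sequence) x)%:E)%E.
  apply: ub_ereal_sup => _ [n _ <-]; rewrite lee_fin /block_martingale.
  have D0 : 0 <= 2 ^+ N * \1_(dyadic_interval N zero_sequence) x :> R.
    by rewrite mulr_ge0 ?(ltW N0)// indicE.
  case: leqP => _; first by rewrite normr0.
  by rewrite /block normrM /rademacher normr_sign mul1r dirichlet_pow2E ger0_norm.
rewrite /hardy_norm unlock /Lnorm.
have -> : (2 ^+ N : R) `^ (1 - 1 / p) = ((2 ^+ N) `^ (p - 1)) `^ p^-1.
  by rewrite -powRrM; congr (_ `^ _); field; rewrite gt_eqF.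
rewrite -poweR_EFin; apply: gt0_ler_poweR.
- by rewrite invr_ge0 ltW.
- rewrite in_itv /= leey andbT integral_ge0// => x _; exact: poweR_ge0.
- by rewrite in_itv /= leey andbT lee_fin powR_ge0.
apply: (@le_trans _ _ (\int[mu]_x (((2 ^+ N) `^ p)%:E *
    (\1_(dyadic_interval N zero_sequence) x)%:E))%E).
  apply: ge0_le_integral => //.
  - by move=> x _; exact: poweR_ge0.
  - apply: (measurableT_comp (measurable_poweR p)); apply: measurableT_comp => //.
    exact: measurable_maximal_function (block_martingaleP N).
  - apply: measurable_funeM; exact/measurable_EFinP/measurable_indic.
  move=> x _; rewrite gee0_abs ?maximal_function_ge0//.
  apply: le_trans (gt0_ler_poweR (ltW p0) _ _ (max_le x)) _.
  + by rewrite in_itv /= leey maximal_function_ge0.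
  + by rewrite in_itv /= leey lee_fin mulr_ge0 ?(ltW N0)// indicE.
  rewrite poweR_EFin -EFinM lee_fin powRM ?(ltW N0)// ?indicE//.
  by case: (_ \in _); rewrite ?powR1// powR0// gt_eqF.
rewrite ge0_integralZl_EFin ?powR_ge0//; last exact/measurable_EFinP/measurable_indic.
rewrite integral_indic_interval -EFinM lee_fin powRB ?powRr1 ?exprVn ?(ltW N0)//.
by rewrite (gt_eqF N0) implybT.
Qed.

(** Only the Cesaro mean of order [2 ^ N + 1] is used; its normalising
    constant is at most [2 (2 ^ N + 2) ^ a], and [2 ^ N + 2 <= 4 * 2 ^ N]. *)
Lemma weighted_maximal_lower (a p : R) (phi : nat -> R) N : 0 < a < 1 -> 0 < p ->
  0 < phi (2 ^ N).+1 ->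
  ((((2 * (4 * 2 ^+ N) `^ a) * phi (2 ^ N).+1)^-1)%:E <=
  'N[mu]_p%:E[weighted_maximal a [set n | (0 < n)%N] phi (block_martingale N)])%E.
Proof.
move=> /andP[a0 a1] p0 phi0; set c := _^-1.
have c0 : 0 < c by rewrite invr_gt0 !mulr_gt0// powR_gt0 mulr_gt0// exprn_gt0.
have c_le x : (c%:E <= weighted_maximal a [set n | (0 < n)%N] phi
    (block_martingale N) x)%E.
  apply: (@le_trans _ _ (`|cesaro_mean a (2 ^ N).+1 (block_martingale N) x| /
      phi (2 ^ N).+1)%:E); last by apply: ereal_sup_ubound; exists (2 ^ N).+1.
  have Clow := cesaro_coef_lower a0 a1 (2 ^ N).+1.
  have C0 : 0 < cesaro_coef a (2 ^ N).+1 by apply: lt_le_trans Clow; rewrite powR_gt0.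
  rewrite lee_fin cesaro_mean_block normrM /rademacher normr_sign mulr1.
  rewrite gtr0_norm ?invr_gt0// /c invfM ler_wpM2r ?invr_ge0 ?(ltW phi0)//.
  have U0 : 0 < 2 * (4 * 2 ^+ N) `^ a.
    by rewrite mulr_gt0// powR_gt0 mulr_gt0// exprn_gt0.
  rewrite lef_pV2//.
  apply: le_trans (cesaro_coef_upper a0 a1 _) _; rewrite ler_wpM2l//.
  apply: ge0_ler_powR; rewrite ?nnegrE ?(ltW a0) ?mulr_ge0 ?exprn_ge0//.
  rewrite -natrX -natrM ler_nat; have : (0 < 2 ^ N)%N by rewrite expn_gt0.
  lia.
rewrite unlock /Lnorm.
apply: (@le_trans _ _ ((c `^ p)%:E `^ p^-1)%E).
  by rewrite poweR_EFin -powRrM mulfV ?gt_eqF// powRr1// ltW.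
apply: gt0_ler_poweR.
- by rewrite invr_ge0 ltW.
- by rewrite in_itv /= leey andbT lee_fin powR_ge0.
- rewrite in_itv /= leey andbT integral_ge0// => x _; exact: poweR_ge0.
apply: (@le_trans _ _ (\int[mu]_x cst (c `^ p)%:E x)%E).
  by rewrite integral_cst// [X in (_ * X)%E](probability_setT mu) mule1.
apply: ge0_le_integral => //.
- by move=> x _; rewrite lee_fin powR_ge0.
- apply: (measurableT_comp (measurable_poweR p)); apply: measurableT_comp => //.
  exact: measurable_weighted_maximal.
move=> x _; rewrite /cst -poweR_EFin.
have w0 := le_trans (ltW (c0 : (0 < c%:E)%E)) (c_le x).
rewrite gee0_abs//; apply: gt0_ler_poweR.
- exact: ltW.
- by rewrite in_itv /= leey andbT lee_fin ltW.
- by rewrite in_itv /= leey w0.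
- exact: c_le.
Qed.


Lemma limn_esup_pinfty (u : nat -> \bar R) n (K : R) : limn_esup u = +oo%E ->
  exists m, (n <= m)%N /\ (K%:E < u m)%E.
Proof.
move=> uoo; have : (K%:E < ereal_sup (u @` [set m | (n <= m)%N]))%E.
  apply: lt_le_trans (ltry K) _; rewrite -uoo; apply: ereal_inf_lbound.
  by exists [set m | (n <= m)%N] => //; exact: nbhs_infty_ge.
by move=> /ereal_sup_gt[_ [m nm <-] Km]; exists m.
Qed.

Lemma weighted_maximal_unbounded (a p : R) (phi : nat -> R) : 0 < a < 1 ->
    0 < p -> 0 <= 1 / p - 1 - a ->
    (forall n : nat, (0 < n)%N -> 1 <= phi n) ->
    (forall m n : nat, (0 < m)%N -> (m <= n)%N -> phi m <= phi n) ->
    limn_esup (fun n => (n%:R `^ (1 / p - 1 - a) / phi n)%:E) = +oo%E ->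
  ~ exists C : R, forall F : nat -> dyadic_group -> R, hardy p F ->
    ('N[haar R]_p%:E[weighted_maximal a [set n | (0 < n)%N] phi F]
            <= C%:E * hardy_norm p F)%E.
Proof.
move=> a01 p0; set g := 1 / p - 1 - a => g0 phi1 phimono supoo [C bounded].
(* The threshold is what the bound [small] below, at [2 ^ N], gives for the indices
   [n] with [2 ^ N < n <= 2 * 2 ^ N]. *)
have [n [n2 Kn]] := limn_esup_pinfty 2 (2 `^ g * (8 * `|C|)) supoo.
have a1 : a < 1 by case/andP: a01.
pose N := trunc_log 2 n.-1.
have Nn : (2 ^ N < n)%N.
  by rewrite -ltnS -(prednK (ltnW n2)) !ltnS trunc_logP//; lia.
have nN : (n <= 2 * 2 ^ N)%N.
  by rewrite -expnS -(prednK (ltnW n2)) trunc_log_ltn.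
have P0 : 0 < phi (2 ^ N).+1 by rewrite (lt_le_trans ltr01)// phi1.
set z : R := 2 ^+ N; have z0 : 0 < z by rewrite exprn_gt0.
have small : z `^ g / phi (2 ^ N).+1 <= 8 * `|C|.
  have := bounded (block_martingale N); have norm := hardy_norm_block N p0.
  have fin : hardy p (block_martingale N).
    by split; [exact: block_martingaleP|exact: le_lt_trans norm (ltry _)].
  move=> /(_ fin) le1.
  have C0 : (0 <= `|C|%:E)%E by rewrite lee_fin.
  have C1 : (C%:E <= `|C|%:E)%E by rewrite lee_fin ler_norm.
  have le2 := le_trans (weighted_maximal_lower a01 p0 P0) (le_trans le1
    (le_trans (lee_wpmul2r (Lnorm_ge0 _ _ _) C1) (lee_wpmul2l C0 norm))).
  move: le2; rewrite -EFinM lee_fin -/z; set U := 2 * _ => le2.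
  have Z0 : 0 < z `^ g by rewrite powR_gt0.
  have A0 : 0 < z `^ a by rewrite powR_gt0.
  have U0 : 0 < U by rewrite /U mulr_gt0 ?powR_gt0 ?mulr_gt0.
  have e : z `^ (1 - 1 / p) = (z `^ g)^-1 * (z `^ a)^-1.
    rewrite -!powRN -powRD; last by rewrite (gt_eqF z0) implybT.
    by congr (_ `^ _); rewrite /g; ring.
  have -> : z `^ g / phi (2 ^ N).+1 = z `^ g * U * (U * phi (2 ^ N).+1)^-1.
    by field; rewrite !gt_eqF.
  apply: le_trans (ler_wpM2l _ le2) _; first by rewrite mulr_ge0// ltW.
  have -> : z `^ g * U * (`|C| * z `^ (1 - 1 / p)) = `|C| * (U / z `^ a).
    by rewrite e; field; rewrite !gt_eqF.
  rewrite mulrC ler_wpM2r// ler_pdivrMr// /U powRM ?(ltW z0)// mulrA ler_wpM2r ?(ltW A0)//.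
  have -> : 8 = 2 * 4 :> R by ring.
  by rewrite ler_wpM2l// -[leRHS]powRr1// ler_powR ?ler1n// ltW.
move: Kn; rewrite lte_fin; apply/negP; rewrite -leNgt.
apply: (@le_trans _ _ ((2 * z) `^ g / phi (2 ^ N).+1)).
  apply: ler_pM; rewrite ?powR_ge0 ?invr_ge0 ?(le_trans ler01) ?phi1//.
  - by rewrite ltnW.
  - apply: ge0_ler_powR; rewrite ?nnegrE ?mulr_ge0 ?(ltW z0)//.
    by rewrite /z -natrX -natrM ler_nat.
  - rewrite lef_pV2 ?posrE ?(lt_le_trans ltr01) ?phi1 ?phimono//.
    by rewrite ltnW.
by rewrite powRM ?(ltW z0)// -mulrA ler_wpM2l ?powR_ge0.
Qed.

End counterexample.

Theorem theorem1 (R : realType) (alpha p : R)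
    (halpha : 0 < alpha < 1) (hp : 0 < p < 1 / (1 + alpha)) :
  (exists c : R, forall F : nat -> dyadic_group -> R, hardy p F ->
     ('N[haar R]_p%:E[weighted_maximal alpha setT
          (fun n => (n%:R + 1) `^ (1 / p - 1 - alpha))%R F]
        <= c%:E * hardy_norm p F)%E)
  /\
  (forall phi : nat -> R,
     (forall n : nat, (0 < n)%N -> 1 <= phi n) ->
     (forall m n : nat, (0 < m)%N -> (m <= n)%N -> phi m <= phi n) ->
     limn_esup (fun n => (n%:R `^ (1 / p - 1 - alpha) / phi n)%:E) = +oo%E ->
     ~ exists C : R, forall F : nat -> dyadic_group -> R, hardy p F ->
         ('N[haar R]_p%:E[weighted_maximal alpha [set n | (0 < n)%N] phi F]
            <= C%:E * hardy_norm p F)%E).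
Proof.
have [/andP[a0 a1] /andP[p0 pa]] := (halpha, hp).
have pa1 : p * (1 + alpha) < 1 by rewrite -ltr_pdivlMr// addr_gt0.
split.
  exists ((2 * majorant_const alpha p) `^ p^-1) => F [mF _].
  exact: weighted_maximal_bounded.
move=> phi phi1 phimono supoo; apply: weighted_maximal_unbounded => //.
rewrite -addrA -opprD subr_ge0 ler_pdivlMr// mulrC.
exact: ltW.
Qed.
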